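(* Let $U\subset\mathbb{C}^d$ be open, let $P_i:U\to\mathbb{C}^{n_i\times n_i}$ ($1\le i\le d$) be analytic, and let $\mathbf z^*=(z_1^*,\dots,z_d^* )\in U$ be a simple eigenvalue of the multiparameter eigenvalue problem $P=\{P_i\}_{i=1}^d$, the only eigenvalue of $P$ in $U$, with right eigenvectors $\mathbf v_1,\dots,\mathbf v_d$ and left eigenvectors $\mathbf w_1,\dots,\mathbf w_d$ (so $\mathbf v_i,\mathbf w_i\in\mathbb{C}^{n_i}\setminus\{0\}$, $P_i(\mathbf z^* )\mathbf v_i=0$ and $\mathbf w_i^HP_i(\mathbf z^* )=0$). Assume the eigenvectors are scaled so that $$\mathbf w_i^H\,\frac{\partial P_i}{\partial \det(P_i)}(\mathbf z^* )\,\mathbf v_i=1,\qquad 1\le i\le d.$$ Let $p_i=\det(P_i)$ and let $Jp$ be the Jacobian matrix of the system $p=\{p_i\}_{i=1}^d$. Let $g:U\to\mathbb{C}$ be holomorphic. Then, for sufficiently small $\epsilon>0$ in the definition of the matrix Grothendieck residue, $$\operatorname{Res}_P(g,\mathbf z^* )=\frac{g(\mathbf z^* )}{\det(Jp(\mathbf z^* ))}\,(\mathbf v_1\otimes\cdots\otimes\mathbf v_d)(\mathbf w_1\otimes\cdots\otimes\mathbf w_d)^H .$$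
   Context: A point $\mathbf z^*$ is an eigenvalue of $P$ if all $P_i(\mathbf z^* )$, $1\le i\le d$, are singular. It is a simple eigenvalue if it is a simple root of the scalar analytic system $p=\{\det(P_i)\}_{i=1}^d$, i.e. $p(\mathbf z^* )=0$ and $\det(Jp(\mathbf z^* ))\ne0$, where $Jp=(\partial p_i/\partial z_j)_{i,j}$. Since $\mathbf z^*$ is simple, $x_i=\det(P_i(\mathbf z))$, $1\le i\le d$, are local holomorphic coordinates near $\mathbf z^*$; $\frac{\partial P_i}{\partial\det(P_i)}$ denotes the partial derivative of $P_i$, expressed in the coordinates $(x_1,\dots,x_d)$, with respect to $x_i$ (the other $x_j$ held fixed). $\otimes$ is the Kronecker product and $^H$ the conjugate transpose. Put $d\mathbf z=dz_1\wedge\cdots\wedge dz_d$. The matrix-valued form is $$\omega(\mathbf z)=g(\mathbf z)\,\bigl(P_1(\mathbf z)\otimes\cdots\otimes P_d(\mathbf z)\bigr)^{-1}d\mathbf z .$$ For $\epsilon>0$ let $\Gamma=\{\mathbf z\in U:\ |\det(P_i(\mathbf z))|=\epsilon,\ 1\le i\le d\}$, oriented by $d(\arg p_1)\wedge\cdots\wedge d(\arg p_d)\ge0$; $U$ is taken to be a bounded neighborhood of $\mathbf z^*$ such that the $P_i$ and $g$ are analytic on a neighborhood of $\overline U$ and $\overline U$ contains no eigenvalue other than $\mathbf z^*$, and $\epsilon$ is taken small enough that $\Gamma$ is a compact subset of $U$. The matrix Grothendieck residue of $P$ with respect to $g$ at $\mathbf z^*$ is $$\operatorname{Res}_P(g,\mathbf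 z^* )=\left(\frac1{2\pi i}\right)^d\int_\Gamma\omega .$$ *)

(* Defs.v *)
From HB Require Import structures.
From mathcomp Require Import all_boot all_order all_algebra.
From mathcomp Require Import all_classical all_reals all_analysis.
From mathcomp Require Import complex mxtens.

Set Implicit Arguments.
Unset Strict Implicit.
Unset Printing Implicit Defensive.

Import Order.TTheory GRing.Theory Num.Theory.
Import numFieldNormedType.Exports.

Local Open Scope classical_set_scope.
Local Open Scope ring_scope.
Local Open Scope complex_scope.
Local Open Scope sesquilinear_scope.

(* R[i] behind an alias at numClosedFieldType: MathComp-Analysis attaches the
   topology and the C-normed-module structure to (abstract) numeric fields, and
   not to the type constructor complex. *)
Definition Cplx (R : realType) : numClosedFieldType := R[i].

(* C^1 in the sense of the scalar field K.  For K = R this is the usual C^1.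
   For K = C the differential is C-linear, and C1_on on an open set is the
   textbook definition of a holomorphic function of several variables as a C^1
   function satisfying the Cauchy-Riemann equations. *)
Definition C1_on (K : numFieldType) (d : nat) (W : set 'rV[K]_d)
    (f : 'rV[K]_d -> K) : Prop :=
  (forall z, W z -> differentiable f z) /\
  (forall (j : 'I_d) z, W z ->
     {for z, continuous (fun y => 'D_(delta_mx 0 j) f y)}).

Definition holomorphic_on (R : realType) (d : nat) (W : set 'rV[Cplx R]_d)
    (f : 'rV[Cplx R]_d -> Cplx R) : Prop :=
  C1_on W f.

Fixpoint kron_dim (d : nat) : ('I_d -> nat) -> nat :=
  match d with
  | 0 => fun=> 1%N
  | d'.+1 => fun n => (n ord0 * kron_dim (fun i => n (lift ord0 i)))%N
  end.

(* A_1 (x) (A_2 (x) (... (x) A_d)), with rows and columns in the usual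
   (lexicographic) order of Kronecker products. *)
Fixpoint kron (T : pzRingType) (d : nat) :
    forall m n : 'I_d -> nat, (forall i, 'M[T]_(m i, n i)) ->
    'M[T]_(kron_dim m, kron_dim n) :=
  match d with
  | 0 => fun _ _ _ => 1%:M
  | d'.+1 => fun m n A => A ord0 *t kron (fun i => A (lift ord0 i))
  end.

Section MultiparameterEigenvalueProblem.
Variables (R : realType) (d : nat) (n : 'I_d -> nat).
Local Notation C := (Cplx R).
Variable P : forall i : 'I_d, 'rV[C]_d -> 'M[C]_(n i).

Definition det_system (z : 'rV[C]_d) : 'rV[C]_d := \row_i \det (P i z).

Definition jac_det_system (z : 'rV[C]_d) : 'M[C]_d :=
  \matrix_(i, j) 'D_(delta_mx 0 j) (fun y => \det (P i y)) z.

Definition is_eigenvalue (z : 'rV[C]_d) : Prop :=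
  forall i, P i z \notin unitmx.

Definition is_simple_eigenvalue (z : 'rV[C]_d) : Prop :=
  [/\ is_eigenvalue z, det_system z = 0 & \det (jac_det_system z) != 0].

End MultiparameterEigenvalueProblem.

(* The continuity of G at F z makes the germ of G at F z unique. *)
Definition is_local_inverse (R : realType) (d : nat)
    (F : 'rV[Cplx R]_d -> 'rV[Cplx R]_d) (z : 'rV[Cplx R]_d)
    (G : 'rV[Cplx R]_d -> 'rV[Cplx R]_d) : Prop :=
  [/\ {for F z, continuous G},
      \forall y \near z, G (F y) = y
    & \forall x \near F z, F (G x) = x].

Definition local_inverse (R : realType) (d : nat)
    (F : 'rV[Cplx R]_d -> 'rV[Cplx R]_d) (z : 'rV[Cplx R]_d) :
    'rV[Cplx R]_d -> 'rV[Cplx R]_d :=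
  xget (fun=> z) [set G | is_local_inverse F z G].

(* The partial derivative of P_i with respect to x_i at z, in the local
   coordinates x = (det P_1, ..., det P_d) around z. *)
Definition dP_ddet (R : realType) (d : nat) (n : 'I_d -> nat)
    (P : forall i : 'I_d, 'rV[Cplx R]_d -> 'M[Cplx R]_(n i))
    (i : 'I_d) (z : 'rV[Cplx R]_d) : 'M[Cplx R]_(n i) :=
  \matrix_(a, b)
    'D_(delta_mx 0 i)
      (fun x => P i (local_inverse (det_system P) z x) a b) (det_system P z).

(* Integral over [0, 2 pi]^d, as an iterated integral; the integrands below are
   continuous. *)
Fixpoint cube_Rintegral (R : realType) (d : nat) : ('rV[R]_d -> R) -> R :=
  match d with
  | 0 => fun F => F 0
  | d'.+1 => fun F =>
      \int[lebesgue_measure]_(t in `[0, 2 * pi])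
        cube_Rintegral (fun u : 'rV[R]_d' => F (row_mx (t%:M : 'rV[R]_1) u))
  end.

Definition cube_integral (R : realType) (d : nat) (F : 'rV[R]_d -> Cplx R) :
    Cplx R :=
  cube_Rintegral (fun t => complex.Re (F t)) +i*
  cube_Rintegral (fun t => complex.Im (F t)).

Section Residue.
Variables (R : realType) (d : nat) (n : 'I_d -> nat).
Local Notation C := (Cplx R).

Definition Re_coord (gam : 'rV[R]_d -> 'rV[C]_d) (j : 'I_d) (t : 'rV[R]_d) : R :=
  complex.Re (gam t 0 j).

Definition Im_coord (gam : 'rV[R]_d -> 'rV[C]_d) (j : 'I_d) (t : 'rV[R]_d) : R :=
  complex.Im (gam t 0 j).

Definition jac_param (gam : 'rV[R]_d -> 'rV[C]_d) (t : 'rV[R]_d) : 'M[C]_d :=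
  \matrix_(j, k) ('D_(delta_mx 0 k) (Re_coord gam j) t +i*
                  'D_(delta_mx 0 k) (Im_coord gam j) t).

(* gam^*(f dz_1 /\ ... /\ dz_d) = pullback f gam dt_1 /\ ... /\ dt_d. *)
Definition pullback (f : 'rV[C]_d -> C) (gam : 'rV[R]_d -> 'rV[C]_d)
    (t : 'rV[R]_d) : C :=
  f (gam t) * \det (jac_param gam t).

Variable P : forall i : 'I_d, 'rV[C]_d -> 'M[C]_(n i).
Variables (U : set 'rV[C]_d) (eps : R).

Definition Gamma : set 'rV[C]_d :=
  [set z | U z /\ forall i, `|\det (P i z)| = (eps%:C : C)].

(* A parametrization of Gamma by the coordinates t_i = arg p_i, i.e. by finitely
   many C^1 sheets gam c with p_i (gam c t) = eps * exp(i t_i), such that each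
   point of Gamma is gam c t for exactly one sheet c and one t in [0, 2 pi)^d.
   The pullback of d(arg p_1) /\ ... /\ d(arg p_d) is dt_1 /\ ... /\ dt_d, so the
   sheets are positively oriented.  The map p : Gamma -> {|x_i| = eps} is a
   finite covering whenever Gamma is compact and Jp is invertible along it, so
   such sheets, defined on R^d, exist in that case; for each t the set of points
   gam c t is a fibre of p, so the family is unique up to permuting the sheets
   at each t. *)
Definition arg_parametrization (m : nat)
    (gam : 'I_m -> 'rV[R]_d -> 'rV[C]_d) : Prop :=
  [/\ forall c j, C1_on setT (Re_coord (gam c) j) /\
                  C1_on setT (Im_coord (gam c) j),
      forall c t, Gamma (gam c t) /\
        forall i, \det (P i (gam c t)) =
                  (eps%:C : C) * (cos (t 0 i) +i* sin (t 0 i))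
    & forall z, Gamma z ->
        exists! ct : 'I_m * 'rV[R]_d,
          (forall i, 0 <= ct.2 0 i < 2 * pi) /\ gam ct.1 ct.2 = z].

Definition Gamma_cycle : Prop :=
  compact Gamma /\
  exists (m : nat) (gam : 'I_m -> 'rV[R]_d -> 'rV[C]_d), arg_parametrization gam.

(* The integral over Gamma of f dz_1 /\ ... /\ dz_d; the value does not depend
   on the parametrization, and xget only selects it. *)
Definition Gamma_integral (f : 'rV[C]_d -> C) : C :=
  xget 0 [set I | exists (m : nat) (gam : 'I_m -> 'rV[R]_d -> 'rV[C]_d),
    arg_parametrization gam /\
    I = \sum_(c < m) cube_integral (pullback f (gam c))].

Definition omega_coef (g : 'rV[C]_d -> C) (z : 'rV[C]_d) :
    'M[C]_(kron_dim n, kron_dim n) :=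
  g z *: invmx (kron (fun i => P i z)).

Definition matrix_residue (g : 'rV[C]_d -> C) :
    'M[C]_(kron_dim n, kron_dim n) :=
  (1 / (0 +i* (2 * pi) : C)) ^+ d *:
  \matrix_(a, b) Gamma_integral (fun z => omega_coef g z a b).

End Residue.

(* Main.v *)
(* The map p = (det P_1, ..., det P_d) has a holomorphic local inverse G at the
   eigenvalue z0, so that for small epsilon Gamma is the single sheet t |-> G(x) over
   the torus x_k = epsilon exp(i t_k).  Since P_i adj(P_i) = x_i, the pullback of
   omega is i^d h(x) dt with
     h(x) = g(G x) det(JG(x)) (adj P_1(G x) (x) ... (x) adj P_d(G x)),
   and h has the mean value property in each variable, whence
   Res = h(0) = g(z0) / det(Jp(z0)) (adj P_1(z0) (x) ... (x) adj P_d(z0)).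
   The adjugate of P_i(z0) has rank at most one; differentiating adj(P_i) P_i = x_i
   with respect to x_i identifies it with v_i w_i^H.
   The factor det(JG) is only known to be continuous: h is therefore approximated
   pointwise boundedly by C^1 functions, using difference quotients of G. *)

(* Holomorphy is given as C^1 over the complex field, so the differentiability of the Jacobian of
   [G] would ask for second derivatives, that is, for a Cauchy formula. The proof avoids it. For a
   C^1 function the mean over a circle is differentiated in the radius; the Cauchy-Riemann equations
   turn the result into the integral of an angular derivative over a full period, which vanishes.
   The mean value property passes to bounded pointwise limits, and the functions that are such
   limits form an algebra, so it reaches the product of det(JG) with adjugates. The uniform bound on
   the difference quotients is the Lipschitz constant of [G], which the construction of [G]
   supplies. Two facts reduce the residue to one sheet. Away from [z0] the modulus of the system has
   a positive minimum on the closure of [U], so for small epsilon Gamma lies where the system is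
   injective. There every sheet of an admissible parametrization must be the one built here, so the
   value selected by [xget] is determined. *)
Require Import Defs.
From HB Require Import structures.
From mathcomp Require Import all_boot all_order all_algebra.
From mathcomp Require Import all_classical all_reals all_analysis.
From mathcomp Require Import complex mxtens.
From mathcomp Require Import ring lra.

Set Implicit Arguments.
Unset Strict Implicit.
Unset Printing Implicit Defensive.

Import Order.TTheory GRing.Theory Num.Theory.
Import numFieldNormedType.Exports.

Local Open Scope classical_set_scope.
Local Open Scope ring_scope.
Local Open Scope sesquilinear_scope.
Local Open Scope complex_scope.

(** * The modulus of a complex number as a real number *)

Section ComplexModulus.
Variable R : realType.
Local Notation C := (Cplx R).
Local Notation Re := (@complex.Re R).
Local Notation Im := (@complex.Im R).

(** The norm on [C] takes values in [C], whose order is only partial. Estimates, extrema and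
    integrals are carried out with this real version. *)
Definition cmod (z : C) : R := Re `|z|.

Lemma normcE (z : C) : `|z| = (cmod z)%:C :> C.
Proof. by rewrite /cmod; case: z => a b; rewrite normc_def. Qed.

Lemma cmodE (z : C) : cmod z = Num.sqrt (Re z ^+ 2 + Im z ^+ 2).
Proof. by rewrite /cmod normc_def. Qed.

Lemma complex_eqP (x y : C) : Re x = Re y -> Im x = Im y -> x = y.
Proof. by case: x => a b; case: y => c d /= -> ->. Qed.

Lemma lerC (a b : R) : ((a%:C : C) <= b%:C) = (a <= b).
Proof. exact: lecR. Qed.

Lemma ltrC (a b : R) : ((a%:C : C) < b%:C) = (a < b).
Proof. exact: ltcR. Qed.

Lemma cmod_ge0 (z : C) : 0 <= cmod z.
Proof. by rewrite cmodE sqrtr_ge0. Qed.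

Lemma cmodD (x y : C) : cmod (x + y) <= cmod x + cmod y.
Proof.
rewrite -lerC.
have -> : (((cmod x + cmod y)%:C : C)) = (cmod x)%:C + (cmod y)%:C.
  by apply: complex_eqP; rewrite /= ?addr0.
by rewrite -!normcE ler_normD.
Qed.

Lemma cmodM (x y : C) : cmod (x * y) = cmod x * cmod y.
Proof.
apply: (@complexI R); rewrite -[LHS]normcE normrM !normcE.
by rewrite /real_complex_def; simpc.
Qed.

Lemma cmodN (x : C) : cmod (- x) = cmod x.
Proof. by rewrite /cmod normrN. Qed.

Lemma cmodB (x y : C) : cmod (x - y) = cmod (y - x).
Proof. by rewrite -cmodN opprB. Qed.

Lemma cmod0 : cmod (0 : C) = 0.
Proof. by rewrite /cmod normr0. Qed.

Lemma cmod1 : cmod (1 : C) = 1.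
Proof. by rewrite /cmod normr1. Qed.

Lemma cmod_eq0 (x : C) : (cmod x == 0) = (x == 0).
Proof.
by rewrite -(normr_eq0 x) normcE eq_complex /= eqxx andbT.
Qed.

Lemma cmod_gt0 (x : C) : (0 < cmod x) = (x != 0).
Proof. by rewrite lt_def cmod_ge0 andbT cmod_eq0. Qed.

Lemma cmodV (x : C) : cmod x^-1 = (cmod x)^-1.
Proof.
have [->|x0] := eqVneq x 0; first by rewrite invr0 cmod0 invr0.
apply: (mulfI (x := cmod x)); first by rewrite cmod_eq0.
by rewrite -cmodM divff // cmod1 divff // cmod_eq0.
Qed.

Lemma cmodC (r : R) : cmod (r%:C : C) = `|r|.
Proof. by rewrite cmodE /= expr0n addr0 sqrtr_sqr. Qed.

Lemma Re_le_cmod (z : C) : `|Re z| <= cmod z.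
Proof. by rewrite cmodE -sqrtr_sqr ler_wsqrtr // lerDl sqr_ge0. Qed.

Lemma Im_le_cmod (z : C) : `|Im z| <= cmod z.
Proof. by rewrite cmodE -sqrtr_sqr ler_wsqrtr // lerDr sqr_ge0. Qed.

Lemma ReCM (x y : C) : Re (x * y) = Re x * Re y - Im x * Im y.
Proof. by case: x => a b; case: y => c d. Qed.

Lemma ImCM (x y : C) : Im (x * y) = Re x * Im y + Im x * Re y.
Proof. by case: x => a b; case: y => c d. Qed.

Lemma ReCD (x y : C) : Re (x + y) = Re x + Re y.
Proof. by case: x => a b; case: y => c d. Qed.

Lemma ImCD (x y : C) : Im (x + y) = Im x + Im y.
Proof. by case: x => a b; case: y => c d. Qed.

Lemma ReCN (x : C) : Re (- x) = - Re x.
Proof. by case: x => a b. Qed.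

Lemma ImCN (x : C) : Im (- x) = - Im x.
Proof. by case: x => a b. Qed.

Lemma Re_sum (I : Type) (s : seq I) (Q : pred I) (F : I -> C) :
  Re (\sum_(i <- s | Q i) F i) = \sum_(i <- s | Q i) Re (F i).
Proof. by apply: (big_morph Re ReCD). Qed.

Lemma cmod_le_ReIm (z : C) : cmod z <= `|Re z| + `|Im z|.
Proof.
have -> : z = (Re z)%:C + (0 +i* 1) * (Im z)%:C.
  by case: z => a b; apply: complex_eqP; rewrite /= ?ReCD ?ImCD ?ReCM ?ImCM /=; ring.
apply: le_trans (cmodD _ _) _; rewrite cmodM !cmodC.
have -> : cmod (0 +i* 1) = 1 by rewrite cmodE /= expr0n expr1n add0r sqrtr1.
by rewrite mul1r ReCD ImCD ReCM ImCM /= !(mul0r,mul1r,subr0,add0r,addr0).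
Qed.

Lemma cmod_sum (I : Type) (s : seq I) (Q : pred I) (F : I -> C) :
  cmod (\sum_(i <- s | Q i) F i) <= \sum_(i <- s | Q i) cmod (F i).
Proof.
apply: (big_ind2 (fun x y => cmod x <= y)) => [|x x' y y' h h'|i Qi].
- by rewrite cmod0.
- exact: le_trans (cmodD _ _) (lerD h h').
- by [].
Qed.

Lemma cplx_gt0 (e : C) : 0 < e -> exists2 r : R, 0 < r & e = r%:C.
Proof.
rewrite (ltcE 0 e) /= => /andP[/eqP e0 r0].
by exists (Re e) => //; apply: complex_eqP.
Qed.

Lemma cvg_cplxP (T : Type) (F : set_system T) (FF : Filter F)
    (f : T -> C) (l : C) :
  f @ F --> l <->
  forall e : R, 0 < e -> \forall t \near F, cmod (l - f t) < e.
Proof.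
split=> [/cvgrPdist_lt h e e0|h].
  have e0' : (0 : C) < e%:C by rewrite ltrC.
  by move: (h _ e0'); apply: filterS => t; rewrite normcE ltrC.
apply/cvgrPdist_lt => e /cplx_gt0[r r0 ->].
by move: (h r r0); apply: filterS => t; rewrite normcE ltrC.
Qed.

Lemma cvg_Re (T : Type) (F : set_system T) (FF : Filter F)
    (f : T -> C) (l : C) : f @ F --> l -> (fun t => Re (f t)) @ F --> Re l.
Proof.
move=> /cvg_cplxP h; apply/cvgrPdist_lt => e e0.
move: (h e e0); apply: filterS => t; apply: le_lt_trans.
by rewrite -ReCN -ReCD Re_le_cmod.
Qed.

Lemma cvg_cmod (T : Type) (F : set_system T) (FF : Filter F)
    (f : T -> C) (l : C) : f @ F --> l -> (fun t => cmod (f t)) @ F --> cmod l.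
Proof.
move=> /cvg_cplxP h; apply/cvgrPdist_lt => e e0.
move: (h e e0); apply: filterS => t; apply: le_lt_trans.
rewrite ler_norml; apply/andP; split.
  rewrite lerBrDr addrC lerBlDr -{1}[f t](subKr l).
  by rewrite (le_trans (cmodD _ _)) // cmodN.
by rewrite lerBlDr -{1}[l](subrK (f t)) cmodD.
Qed.

Lemma cvg_complex (T : Type) (F : set_system T) (FF : Filter F)
    (f g : T -> R) (l m : R) : f @ F --> l -> g @ F --> m ->
  (fun t => f t +i* g t : C) @ F --> (l +i* m : C).
Proof.
move=> /cvgrPdist_lt hf /cvgrPdist_lt hg; apply/cvg_cplxP => e e0.
have e2 : 0 < e / 2 by rewrite divr_gt0.
near=> t.
apply: le_lt_trans (cmod_le_ReIm _) _; rewrite /= (splitr e) ltrD //.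
  by near: t; exact: hf.
by near: t; exact: hg.
Unshelve. all: by end_near. Qed.

End ComplexModulus.

(** * Algebras of functions *)

Definition funalg (T : Type) (K : comPzRingType) (Q : (T -> K) -> Prop) :=
  [/\ forall c, Q (fun=> c),
      forall f g, Q f -> Q g -> Q (fun t => f t + g t)
    & forall f g, Q f -> Q g -> Q (fun t => f t * g t)].

Section FunctionAlgebra.
Variables (T : Type) (K : comPzRingType) (Q : (T -> K) -> Prop).
Hypothesis HQ : funalg Q.

Let Q_eq (f g : T -> K) : f =1 g -> Q g -> Q f.
Proof. by move=> /funext ->. Qed.

Lemma funalg_sum (I : Type) (s : seq I) (p : pred I) (f : I -> T -> K) :
  (forall i, p i -> Q (f i)) -> Q (fun t => \sum_(i <- s | p i) f i t).
Proof.
case: HQ => Qc QD _ H; elim: s => [|i s IH].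
  by apply: Q_eq => [t|]; [rewrite big_nil; reflexivity|exact: Qc].
apply: Q_eq => [t|]; first by rewrite big_cons; reflexivity.
by case: (p i) (H i) => [/(_ isT) Hi|_]; [exact: QD|exact: IH].
Qed.

Lemma funalg_prod (I : Type) (s : seq I) (p : pred I) (f : I -> T -> K) :
  (forall i, p i -> Q (f i)) -> Q (fun t => \prod_(i <- s | p i) f i t).
Proof.
case: HQ => Qc _ QM H; elim: s => [|i s IH].
  by apply: Q_eq => [t|]; [rewrite big_nil; reflexivity|exact: Qc].
apply: Q_eq => [t|]; first by rewrite big_cons; reflexivity.
by case: (p i) (H i) => [/(_ isT) Hi|_]; [exact: QM|exact: IH].
Qed.

(** Determinants, and likewise adjugates and Kronecker products below, are polynomials in the
    entries. One argument thus serves continuous functions, C^1 functions and the limit class. *)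
Lemma funalg_det n (A : T -> 'M[K]_n) :
  (forall i j, Q (fun t => A t i j)) -> Q (fun t => \det (A t)).
Proof.
case: HQ => Qc _ QM H; apply: funalg_sum => s _; apply: QM; first exact: Qc.
by apply: funalg_prod => i _; exact: H.
Qed.

Lemma funalg_adj n (A : T -> 'M[K]_n) :
  (forall i j, Q (fun t => A t i j)) -> forall i j, Q (fun t => (\adj (A t)) i j).
Proof.
case: HQ => Qc _ QM H i j; apply: Q_eq => [t|]; first by rewrite mxE; reflexivity.
apply: QM; first exact: Qc.
by apply: funalg_det => k l; apply: Q_eq => [t|]; [rewrite !mxE; reflexivity|exact: H].
Qed.

Lemma funalg_kron d : forall (m n : 'I_d -> nat)
    (A : forall i, T -> 'M[K]_(m i, n i)),
  (forall i a b, Q (fun t => A i t a b)) ->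
  forall a b, Q (fun t => kron (fun i => A i t) a b).
Proof.
case: HQ => Qc _ QM; elim: d => [|d IH] m n A H a b.
  by apply: Q_eq => [t|]; [rewrite mxE; reflexivity|exact: Qc].
apply: Q_eq => [t|]; first by rewrite mxE; reflexivity.
apply: QM; first exact: H.
exact: (IH _ _ (fun i => A (lift ord0 i))).
Qed.

End FunctionAlgebra.

Lemma funalg_continuous (K : numFieldType) (T : topologicalType) (x : T) :
  funalg (fun f : T -> K => {for x, continuous f}).
Proof.
split=> [c|f g cf cg|f g cf cg]; first exact: cvg_cst.
  exact: (@continuousD K K^o T f g x cf cg).
exact: (@continuousM K T f g x cf cg).
Qed.

(** * First-order expansions *)

Section Expansions.
Variable K : numFieldType.

Lemma is_deriveP (V W : normedModType K) (f : V -> W) (a v : V) (D : W) :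
  is_derive a v f D <->
  forall e : K, 0 < e -> \forall h \near (0 : K),
    `|f (h *: v + a) - f a - h *: D| <= e * `|h|.
Proof.
split=> [[df <-] e e0|H].
  have /eqaddoP /(_ e e0) := derivable_nbhs df.
  apply: filterS => h /=.
  by rewrite opprD addrA.
suff cv : (fun h => h^-1 *: ((f \o shift a) (h *: v) - f a)) @ 0^' --> D.
  split; last exact: cvg_lim.
  by apply/cvg_ex; exists D.
apply/cvgrPdist_le => e e0; near=> h.
have h0 : h != 0 by near: h; exact: nbhs_dnbhs_neq.
have hh : `|f (h *: v + a) - f a - h *: D| <= e * `|h|.
  by near: h; apply: nbhs_dnbhs; exact: H.
rewrite /=.
rewrite -[D](scalerK h0) -scalerBr normrZ distrC normfV.
rewrite ler_pdivrMl ?normr_gt0 // mulrC.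
Unshelve. all: by end_near. Qed.

Lemma differentiable_approx (V W : normedModType K) (f : V -> W) (z : V)
    (L : {linear V -> W}) : continuous L ->
  (forall e : K, 0 < e -> \forall h \near (0 : V),
     `|f (h + z) - f z - L h| <= e * `|h|) ->
  differentiable f z /\ 'd f z = L :> (V -> W).
Proof.
move=> Lc H.
have eqo : f \o shift z = cst (f z) + L +o_ 0 id.
  apply/eqaddoP => e e0; move: (H e e0); apply: filterS => h /=.
  by rewrite !fctE opprD addrA.
have dE := diff_unique Lc eqo.
by split=> //; apply/diff_locallyP; rewrite dE.
Qed.

Lemma approx_differentiable (V W : normedModType K) (f : V -> W) (z : V) :
  differentiable f z ->
  forall e : K, 0 < e -> \forall h \near (0 : V),
     `|f (h + z) - f z - 'd f z h| <= e * `|h|.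
Proof.
move=> /diff_locally /eqaddoP H e e0; move: (H e e0); apply: filterS => h /=.
by rewrite !fctE opprD addrA.
Qed.

Section RowVector.
Variable d : nat.
Implicit Types (f : 'rV[K]_d -> K) (z : 'rV[K]_d) (a : 'I_d -> K).

(** Differentiability with gradient [a], for real and complex scalars alike. The remainder is
    measured in the l1 norm because coordinatewise estimates then simply add up. *)
Definition expands f z a := forall e : K, 0 < e -> \forall y \near z,
  `|f y - f z - \sum_j (y 0 j - z 0 j) * a j| <= e * \sum_j `|y 0 j - z 0 j|.

Definition row_form a (h : 'rV[K]_d) : K := \sum_j h 0 j * a j.

Fact row_form_is_linear a : linear (row_form a).
Proof.
move=> k x y; rewrite /row_form scaler_sumr -big_split /=.
by apply: eq_bigr => j _; rewrite !mxE mulrDl -mulrA.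
Qed.

HB.instance Definition _ a :=
  GRing.isLinear.Build K 'rV[K]_d K *:%R (row_form a) (row_form_is_linear a).

Lemma ler_coord_mx_norm (h : 'rV[K]_d) j : `|h 0 j| <= `|h|.
Proof.
rewrite [leRHS]/Num.norm /= mx_normE -[leLHS]nngE num_le.
exact: (le_bigmax _ (fun i : 'I_1 * 'I_d => `|h i.1 i.2|%:nng) (0, j)).
Qed.

Lemma row_form_continuous a : continuous (row_form a).
Proof.
move=> x; have [cc _ cM] := @funalg_continuous K 'rV[K]_d x.
have H := @funalg_sum _ _ _ (@funalg_continuous K 'rV[K]_d x) _ (index_enum 'I_d)
  xpredT (fun j (h : 'rV[K]_d) => h 0 j * a j).
apply: H => j _.
by apply: (cM (fun h : 'rV[K]_d => h 0 j) (fun=> a j)); [exact: coord_continuous|exact: cc].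
Qed.

Lemma sum_coord_le (h : 'rV[K]_d) : \sum_j `|h 0 j| <= d%:R * `|h|.
Proof.
rewrite mulr_natl -[X in _ *+ X]card_ord -sumr_const.
by apply: ler_sum => j _; exact: ler_coord_mx_norm.
Qed.

Lemma mx_norm_le_sum (h : 'rV[K]_d) : `|h| <= \sum_j `|h 0 j|.
Proof.
have [/eqP ->|] := boolP (`|h| == 0); first by apply: sumr_ge0.
rewrite [`|h|]/Num.norm /= => /mx_norm_neq0 [[i j] ->] /=.
by rewrite ord1 (bigD1 j) //= lerDl sumr_ge0.
Qed.

Lemma row_form_delta a j : row_form a (delta_mx 0 j) = a j.
Proof.
rewrite /row_form (bigD1 j) //= mxE !eqxx mul1r big1 ?addr0 // => k kj.
by rewrite mxE (negbTE kj) mul0r.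
Qed.

Lemma expands_differentiable f z a : expands f z a ->
  differentiable f z /\ forall j, 'D_(delta_mx 0 j) f z = a j.
Proof.
move=> H.
have Hc := @row_form_continuous a.
have [|df dE] := differentiable_approx Hc (f := f) (z := z).
  (* The factor [d] lost between the l1 norm and the max norm is absorbed here; the successor covers
     [d = 0]. *)
  move=> e e0; have e1 : 0 < e / d.+1%:R by rewrite divr_gt0.
  have /= := H _ e1; rewrite (near_shift 0); apply: filterS => h /=.
  rewrite subr0 => hh.
  have -> : row_form a h = \sum_j ((h + z) 0 j - z 0 j) * a j.
    by apply: eq_bigr => j _; rewrite !mxE addrK.
  apply: le_trans hh _.
  have -> : \sum_j `|(h + z) 0 j - z 0 j| = \sum_j `|h 0 j|.
    by apply: eq_bigr => j _; rewrite !mxE addrK.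
  rewrite -mulrA ler_pM2l // ler_pdivrMl //.
  apply: le_trans (sum_coord_le _) _.
  by rewrite ler_wpM2r // ler_nat.
by split=> // j; rewrite deriveE // dE; exact: row_form_delta.
Qed.

Lemma differentiable_expands f z : differentiable f z ->
  expands f z (fun j => 'D_(delta_mx 0 j) f z).
Proof.
move=> df e e0.
have h0 := approx_differentiable df e0.
rewrite (near_shift 0); near=> h => /=; rewrite subr0.
have -> : \sum_j ((h + z) 0 j - z 0 j) * 'D_(delta_mx 0 j) f z = 'd f z h.
  rewrite {2}[h]row_sum_delta linear_sum.
  by apply: eq_bigr => j _; rewrite !mxE addrK linearZ deriveE.
have hh : `|f (h + z) - f z - 'd f z h| <= e * `|h| by near: h.
apply: le_trans hh _.
rewrite ler_pM2l //; apply: le_trans (mx_norm_le_sum _) _.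
by apply: ler_sum => j _; rewrite !mxE addrK.
Unshelve. all: by end_near. Qed.

End RowVector.
End Expansions.

(** * The l1 norm on complex row vectors *)

Section ComplexVectors.
Variable R : realType.
Local Notation C := (Cplx R).
Local Notation Re := (@complex.Re R).
Local Notation Im := (@complex.Im R).

Definition nrm1 (d : nat) (z : 'rV[C]_d) : R := \sum_j cmod (z 0 j).

Section Nrm1.
Variable d : nat.
Implicit Types x y z : 'rV[C]_d.

Lemma nrm1_ge0 z : 0 <= nrm1 z.
Proof. by apply: sumr_ge0 => j _; exact: cmod_ge0. Qed.

Lemma nrm1D x y : nrm1 (x + y) <= nrm1 x + nrm1 y.
Proof.
by rewrite -big_split; apply: ler_sum => j _; rewrite mxE cmodD.
Qed.

Lemma nrm1N x : nrm1 (- x) = nrm1 x.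
Proof. by apply: eq_bigr => j _; rewrite mxE cmodN. Qed.

Lemma nrm1B x y : nrm1 (x - y) = nrm1 (y - x).
Proof. by rewrite -nrm1N opprB. Qed.

Lemma nrm1_0 : nrm1 (0 : 'rV[C]_d) = 0.
Proof. by rewrite /nrm1 big1 // => j _; rewrite mxE cmod0. Qed.

Lemma nrm1Z (c : C) x : nrm1 (c *: x) = cmod c * nrm1 x.
Proof. by rewrite mulr_sumr; apply: eq_bigr => j _; rewrite mxE cmodM. Qed.

Lemma nrm1_eq0 x : nrm1 x = 0 -> x = 0.
Proof.
move=> /eqP; rewrite psumr_eq0 => [/allP h|j _]; last exact: cmod_ge0.
apply/rowP => j; rewrite mxE; apply/eqP; rewrite -cmod_eq0.
exact: (h j (mem_index_enum _)).
Qed.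

Lemma cmod_le_nrm1 x j : cmod (x 0 j) <= nrm1 x.
Proof.
by rewrite /nrm1 (bigD1 j) //= lerDl sumr_ge0 // => k _; exact: cmod_ge0.
Qed.

Lemma nrm1_triangle x y z : nrm1 (x - z) <= nrm1 (x - y) + nrm1 (y - z).
Proof. by rewrite (le_trans _ (nrm1D _ _)) // addrA subrK. Qed.

Lemma nrm1_delta (c : C) j : nrm1 (c *: delta_mx 0 j : 'rV[C]_d) = cmod c.
Proof.
rewrite /nrm1 (bigD1 j) //= !mxE !eqxx mulr1 big1 ?addr0 // => k kj.
by rewrite !mxE (negbTE kj) mulr0 cmod0.
Qed.

(** The l1 norm and the max norm define the same topology: the max-norm ball of radius [r / d.+1]
    lies in the l1 ball of radius [r]. *)
Lemma nbhs_rVP z (S : set 'rV[C]_d) :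
  nbhs z S <-> exists2 r : R, 0 < r & forall y, nrm1 (y - z) < r -> S y.
Proof.
split=> [/nbhs_ballP[e /= /cplx_gt0[r r0 ->{e}] h]|[r r0 h]].
  exists r => // y yz; apply: h; split; first by rewrite ltrC.
  move=> i j; rewrite -ball_normE /= normcE ltrC ord1 cmodB.
  by apply: le_lt_trans yz; rewrite (le_trans _ (cmod_le_nrm1 _ j)) // !mxE.
have r1 : 0 < r / d.+1%:R by rewrite divr_gt0.
apply/nbhs_ballP; exists ((r / d.+1%:R)%:C : C); first by rewrite /= ltrC.
move=> y [_ yz]; apply: h.
apply: (@le_lt_trans _ _ (\sum_(j < d) r / d.+1%:R)).
  apply: ler_sum => j _; have := yz 0 j.
  by rewrite -ball_normE /= normcE ltrC cmodB !mxE => /ltW.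
rewrite sumr_const card_ord -(mulr_natr (r / _)) -mulrA gtr_pMr // mulrC.
by rewrite ltr_pdivrMr // mul1r ltr_nat.
Qed.

Lemma cvg_rVP (T : Type) (F : set_system T) (FF : Filter F)
    (f : T -> 'rV[C]_d) (l : 'rV[C]_d) :
  f @ F --> l <->
  forall e : R, 0 < e -> \forall t \near F, nrm1 (f t - l) < e.
Proof.
split=> [h e e0|h S /nbhs_rVP[r r0 rS]].
  have /h : nbhs l (fun y => nrm1 (y - l) < e) by apply/nbhs_rVP; exists e.
  by [].
move: (h r r0); apply: filterS => t; exact: rS.
Qed.

Lemma nrm1_continuous : continuous (fun z => nrm1 z).
Proof.
move=> z; apply/(@cvgrPdist_lt _ _ _ (nbhs z) _) => e e0.
apply/nbhs_rVP; exists e => // y yz.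
apply: le_lt_trans yz; rewrite ler_norml.
have := nrm1D (y - z) z; have := nrm1D (z - y) y; rewrite !subrK nrm1B => h1 h2.
by apply/andP; split; lra.
Qed.

Lemma cmod_coord_continuous j : continuous (fun z : 'rV[C]_d => cmod (z 0 j)).
Proof.
move=> z.
exact: (@cvg_cmod _ _ (nbhs z) _ _ _ (@coord_continuous C 1 d 0 j z)).
Qed.

(** Compactness enters the complex plane here, as the continuous image of a product of two real
    segments. *)
Lemma compact_square (r : R) :
  compact [set c : C | `|Re c| <= r /\ `|Im c| <= r].
Proof.
have -> : [set c : C | `|Re c| <= r /\ `|Im c| <= r] =
   (fun p : R * R => p.1 +i* p.2 : C) @` (`[-r, r] `*` `[-r, r]).
  apply/seteqP; split=> [c [cr ci]|c [[a b] [/= a1 b1] <-]].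
    exists (Re c, Im c); last by apply: complex_eqP.
    by split=> /=; rewrite in_itv /= -ler_norml.
  by move: a1 b1; rewrite !in_itv /= -!ler_norml.
apply: continuous_compact; last by apply: compact_setX; exact: segment_compact.
apply: continuous_subspaceT => -[a b].
by apply: cvg_complex; [exact: cvg_fst|exact: cvg_snd].
Qed.

Lemma closed_bounded_compact (A : set 'rV[C]_d) (r : R) : closed A ->
  (forall z, A z -> forall j, cmod (z 0 j) <= r) -> compact A.
Proof.
move=> cA bA.
have cpt := @rV_compact C d (fun=> [set c : C | `|Re c| <= r /\ `|Im c| <= r])
  (fun=> @compact_square r).
apply: (subclosed_compact cA cpt) => z Az j.
split; apply: (le_trans _ (bA z Az j)); [exact: Re_le_cmod|exact: Im_le_cmod].
Qed.

Lemma compact_nrm1_ball z (r : R) : compact [set y | nrm1 (y - z) <= r].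
Proof.
apply: (@closed_bounded_compact _ (r + nrm1 z)).
  have cf : continuous (fun y : 'rV[C]_d => nrm1 (y - z)).
    move=> y; apply: (@continuous_comp _ _ _ (fun y => y - z) (@nrm1 d)).
      have ci : (fun y : 'rV[C]_d => y) @ nbhs y --> y by exact: cvg_id.
      have cz : (fun=> z) @ nbhs y --> z by exact: cvg_cst.
      exact: (@cvgB C 'rV[C]_d _ (nbhs y) _ _ _ _ _ ci cz).
    exact: nrm1_continuous.
  exact: (proj1 (continuous_closedP _) cf _ (@closed_le R r)).
move=> y /= yz j; apply: le_trans (cmod_le_nrm1 _ _) _.
by rewrite -[y](subrK z) (le_trans (nrm1D _ _)) // lerD2r.
Qed.

Lemma expandsP (f : 'rV[C]_d -> C) z a :
  expands f z a <-> forall e : R, 0 < e -> \forall y \near z,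
  cmod (f y - f z - \sum_j (y 0 j - z 0 j) * a j) <= e * nrm1 (y - z).
Proof.
have E (e : R) y : (`|f y - f z - \sum_j (y 0 j - z 0 j) * a j| <=
    (e%:C : C) * \sum_j `|y 0 j - z 0 j|) =
    (cmod (f y - f z - \sum_j (y 0 j - z 0 j) * a j) <= e * nrm1 (y - z)).
  rewrite normcE -lerC; congr (_ <= _).
  rewrite (_ : \sum_j _ = (nrm1 (y - z))%:C); last first.
    rewrite (@big_morph _ _ (fun x : R => x%:C : C) 0 +%R 0 +%R) //.
      by apply: eq_bigr => j _; rewrite normcE !mxE.
    by move=> u v; apply: complex_eqP; rewrite /= ?addr0.
  by apply: complex_eqP; rewrite ?ReCM ?ImCM /= !(mulr0,mul0r,addr0,subr0).
split=> h e; last move=> /cplx_gt0[r r0 ->].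
  move=> e0; have e1 : (0 : C) < e%:C by rewrite ltrC.
  by move: (h _ e1); apply: filterS => y; rewrite E.
by move: (h _ r0); apply: filterS => y; rewrite E.
Qed.

End Nrm1.
End ComplexVectors.

(** * The mean value inequality *)

Lemma segment_coord (K : comPzRingType) d (z z' : 'rV[K]_d) j (s t : K) :
  (z' + s *: (z - z')) 0 j - (z' + t *: (z - z')) 0 j -
  (z 0 j - z' 0 j) * (s - t) = 0.
Proof. by rewrite !mxE; ring. Qed.

Lemma segment_increment (K : comPzRingType) (u a b D S s t : K) :
  u * (a - s * S) - u * (b - t * S) - u * (D - S) * (s - t) =
  u * (a - b - D * (s - t)).
Proof. by ring. Qed.

Lemma segment_combination (K : comPzRingType) d (x y z : 'rV[K]_d) (t : K) :
  y + t *: (z - y) - x = t *: (z - x) + (1 - t) *: (y - x).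
Proof. by apply/rowP => j; rewrite !mxE; ring. Qed.

Section ComplexDifferential.
Variable R : realType.
Local Notation C := (Cplx R).
Local Notation Re := (@complex.Re R).
Local Notation Im := (@complex.Im R).

(* The size of the increment is measured by [sg]; [el] is its linear part. *)
Lemma expands_comp (d : nat) (T : Type) (F : set_system T) (FF : Filter F)
    (sg : T -> R) (y : T -> 'rV[C]_d) (y0 : 'rV[C]_d) (el : 'I_d -> T -> C)
    (B : R) (f : 'rV[C]_d -> C) (a : 'I_d -> C) :
  0 <= B -> (forall s, 0 <= sg s) -> sg @ F --> (0 : R) ->
  (forall j s, cmod (el j s) <= B * sg s) ->
  (forall j (e : R), 0 < e -> \forall s \near F,
     cmod (y s 0 j - y0 0 j - el j s) <= e * sg s) ->
  expands f y0 a ->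
  forall e : R, 0 < e -> \forall s \near F,
    cmod (f (y s) - f y0 - \sum_j el j s * a j) <= e * sg s.
Proof.
move=> B0 sg0 sgF elB yel /expandsP fa e e0.
pose A := \sum_j cmod (a j) + 1.
have A0 : 0 < A by rewrite ltr_wpDl // sumr_ge0 // => j _; exact: cmod_ge0.
pose B1 := d%:R * (B + 1) + 1.
have B10 : 0 < B1 by rewrite ltr_wpDl // mulr_ge0 // addr_ge0.
(* The bound 1 controls the increment of [y] by [B1 * sg]; the bound [e / (2 * A)] lets the error of
   the linear parts cost at most half of [e]. *)
pose e1 := Num.min 1 (e / (2 * A)).
have e10 : 0 < e1 by rewrite lt_min ltr01 divr_gt0 // mulr_gt0.
have yel1 : \forall s \near F, forall j, cmod (y s 0 j - y0 0 j - el j s) <= e1 * sg s.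
  by apply: filter_forall => j; exact: yel.
have nb s : (forall j, cmod (y s 0 j - y0 0 j - el j s) <= e1 * sg s) ->
    nrm1 (y s - y0) <= B1 * sg s.
  move=> h; apply: (@le_trans _ _ (\sum_(j < d) (B + 1) * sg s)).
    apply: ler_sum => j _; rewrite !mxE.
    rewrite -[X in cmod X](subrK (el j s)) (le_trans (cmodD _ _)) //.
    have h' : cmod (y s 0 j - y0 0 j - el j s) <= 1 * sg s.
      by apply: le_trans (h j) _; rewrite ler_wpM2r // ge_min lexx.
    by rewrite mulrDl [leRHS]addrC lerD ?elB.
  rewrite sumr_const card_ord -[X in X <= _]mulr_natl mulrA ler_wpM2r //.
  by rewrite lerDl.
have e2 : 0 < e / (2 * B1) by rewrite divr_gt0 // mulr_gt0.
have /nbhs_rVP[r r0 rP] := fa _ e2.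
have sgr : \forall s \near F, sg s < r / B1.
  have r1 : 0 < r / B1 by rewrite divr_gt0.
  move/cvgrPdist_lt : sgF => /(_ _ r1); apply: filterS => s.
  by rewrite sub0r normrN ger0_norm.
apply: filterS2 yel1 sgr => s h1 h2.
have h3 := nb s h1.
have h4 : nrm1 (y s - y0) < r.
  by apply: le_lt_trans h3 _; rewrite mulrC -ltr_pdivlMr.
have h5 := rP _ h4.
have h6 : cmod (\sum_j (y s 0 j - y0 0 j - el j s) * a j) <= e / 2 * sg s.
  apply: le_trans (cmod_sum _ _ _) _.
  apply: (@le_trans _ _ (\sum_j (e1 * sg s) * cmod (a j))).
    by apply: ler_sum => j _; rewrite cmodM ler_wpM2r // cmod_ge0.
  rewrite -mulr_sumr mulrAC ler_wpM2r //.
  apply: (@le_trans _ _ (e / (2 * A) * A)).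
    apply: ler_pM; rewrite ?(ltW e10) ?sumr_ge0 //.
    - by move=> j _; exact: cmod_ge0.
    - by rewrite ge_min lexx orbT.
    - by rewrite lerDl.
  by rewrite invfM mulrA divfK // gt_eqF.
have -> : f (y s) - f y0 - \sum_j el j s * a j =
   (f (y s) - f y0 - \sum_j (y s 0 j - y0 0 j) * a j) +
   \sum_j (y s 0 j - y0 0 j - el j s) * a j.
  have -> : \sum_j (y s 0 j - y0 0 j - el j s) * a j =
      \sum_j (y s 0 j - y0 0 j) * a j - \sum_j el j s * a j.
    by rewrite -sumrB; apply: eq_bigr => j _; rewrite mulrBl.
  by ring.
apply: le_trans (cmodD _ _) _.
have -> : e * sg s = e / 2 * sg s + e / 2 * sg s by field.
apply: lerD => //; apply: le_trans h5 _.
apply: le_trans (ler_wpM2l (ltW e2) h3) _.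
by rewrite mulrA invfM mulrA divfK // gt_eqF.
Qed.

(* [Cplx R] carries no normed module structure over [R], hence this substitute
   for [is_derive] for functions of a real variable. *)
Definition dRC (phi : R -> C) (t : R) (D : C) := forall e : R, 0 < e ->
  \forall s \near t, cmod (phi s - phi t - D * (s - t)%:C) <= e * `|s - t|.

Lemma dRC_Re phi t D : dRC phi t D -> is_derive t 1 (fun s => Re (phi s)) (Re D).
Proof.
move=> h; apply/is_deriveP => e e0.
move: (h e e0); rewrite (near_shift 0); apply: filterS => s /=.
rewrite subr0 addrK [s *: 1]mulr1; apply: le_trans.
apply: le_trans (Re_le_cmod _).
by rewrite !ReCD !ReCN ReCM /= mulr0 subr0 [Re D * s]mulrC.
Qed.

Lemma dRC_Im phi t D : dRC phi t D -> is_derive t 1 (fun s => Im (phi s)) (Im D).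
Proof.
move=> h; apply/is_deriveP => e e0.
move: (h e e0); rewrite (near_shift 0); apply: filterS => s /=.
rewrite subr0 addrK [s *: 1]mulr1; apply: le_trans.
apply: le_trans (Im_le_cmod _).
by rewrite !ImCD !ImCN ImCM /= mulr0 add0r [Im D * s]mulrC.
Qed.

Lemma dRC_complex (f g : R -> R) (t a b : R) :
  is_derive t 1 f a -> is_derive t 1 g b ->
  dRC (fun s => f s +i* g s : C) t (a +i* b).
Proof.
move=> /is_deriveP hf /is_deriveP hg e e0.
have e2 : 0 < e / 2 by rewrite divr_gt0.
rewrite (near_shift 0); near=> h => /=; rewrite subr0 addrK.
apply: le_trans (cmod_le_ReIm _) _.
rewrite !ReCD !ImCD !ReCN !ImCN ReCM ImCM /= !mulr0 subr0 add0r.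
have -> : e * `|h| = e / 2 * `|h| + e / 2 * `|h| by field.
apply: lerD.
  rewrite [a * h]mulrC.
  have : `|f (h *: 1 + t) - f t - h *: a| <= e / 2 * `|h|.
    by near: h; exact: hf.
  by rewrite [h *: 1]mulr1.
rewrite [b * h]mulrC.
have : `|g (h *: 1 + t) - g t - h *: b| <= e / 2 * `|h|.
  by near: h; exact: hg.
by rewrite [h *: 1]mulr1.
Unshelve. all: by end_near. Qed.

Lemma dRC_comp d (y : R -> 'rV[C]_d) (t : R) (b : 'I_d -> C)
    (f : 'rV[C]_d -> C) (a : 'I_d -> C) :
  (forall j, dRC (fun s => y s 0 j) t (b j)) -> expands f (y t) a ->
  dRC (fun s => f (y s)) t (\sum_j b j * a j).
Proof.
move=> hy fa.
have B0 : 0 <= \sum_j cmod (b j) by apply: sumr_ge0 => j _; exact: cmod_ge0.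
have := @expands_comp d R (nbhs t) _ (fun s => `|s - t|) y (y t)
  (fun j s => b j * (s - t)%:C) _ f a B0.
move=> H e e0.
have : \forall s \near t, cmod (f (y s) - f (y t) -
    \sum_j b j * (s - t)%:C * a j) <= e * `|s - t|.
  apply: H => //.
    apply/(@cvgrPdist_lt R R^o R (nbhs t) _) => e' e'0.
    apply: (@filterS R (nbhs t) _ (ball t e')); last exact: nbhsx_ballx.
    by move=> s; rewrite -ball_normE /= sub0r normrN normr_id distrC.
  move=> j s; rewrite cmodM cmodC ler_wpM2r //.
  by rewrite (bigD1 j) //= lerDl sumr_ge0 // => k _; exact: cmod_ge0.
apply: filterS => s; rewrite mulr_suml.
by under eq_bigr do rewrite mulrAC.
Qed.

(** There is no mean value equality for complex values, so the total error [u] is paired with its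
    conjugate: the real part of [phi] grows by the square of [cmod u] over the segment, while its
    derivative is at most [cmod u] times the desired bound. *)
Lemma segment_mean_value d (f : 'rV[C]_d -> C) (z z' : 'rV[C]_d)
    (a : 'I_d -> C) (c : R) :
  (forall t : R, 0 <= t <= 1 -> let x := z' + (t%:C : C) *: (z - z') in
     differentiable f x /\
     forall j, cmod ('D_(delta_mx 0 j) f x - a j) <= c) ->
  cmod (f z - f z' - \sum_j (z 0 j - z' 0 j) * a j) <= c * nrm1 (z - z').
Proof.
move=> H.
pose S := \sum_j (z 0 j - z' 0 j) * a j.
pose u := f z - f z' - S.
pose p (t : R) := z' + (t%:C : C) *: (z - z').
pose uc : C := (Re u) -i* (Im u).
pose D (t : R) := \sum_j (z 0 j - z' 0 j) * ('D_(delta_mx 0 j) f (p t) - a j).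
pose phi (t : R) := uc * (f (p t) - (t%:C : C) * S).
have dphi t : 0 <= t <= 1 -> dRC phi t (uc * D t).
  move=> /H[df _] e e0.
  have hp j : dRC (fun s => p s 0 j) t (z 0 j - z' 0 j).
    move=> e' e'0; apply: (@filterS R (nbhs t) _ setT); last exact: filterT.
    move=> s _.
    have -> : ((s - t)%:C : C) = s%:C - t%:C by apply: complex_eqP; rewrite /= ?subr0.
    by rewrite segment_coord cmod0 mulr_ge0 // ltW.
  have h := dRC_comp hp (differentiable_expands df).
  have k0 : 0 < cmod uc + 1 by rewrite ltr_wpDl // cmod_ge0.
  move: (h (e / (cmod uc + 1))); rewrite divr_gt0 // => /(_ isT).
  apply: filterS => s hs.
  have -> : phi s - phi t - uc * D t * (s - t)%:C = uc *
     (f (p s) - f (p t) - (\sum_j (z 0 j - z' 0 j) * 'D_(delta_mx 0 j) f (p t)) *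
       (s - t)%:C).
    have -> : D t = \sum_j (z 0 j - z' 0 j) * 'D_(delta_mx 0 j) f (p t) - S.
      by rewrite -sumrB; apply: eq_bigr => j _; rewrite mulrBr.
    have -> : ((s - t)%:C : C) = s%:C - t%:C by apply: complex_eqP; rewrite /= ?subr0.
    exact: segment_increment.
  rewrite cmodM; apply: le_trans (ler_wpM2l (cmod_ge0 _) hs) _.
  rewrite mulrCA -mulrA ler_wpM2l ?(ltW e0) // mulrA ler_piMl //.
  by rewrite ler_pdivrMl // mulr1 lerDl.
have [t t01 E] : exists2 t : R, t \in `[0, 1] &
    Re (phi 1) - Re (phi 0) = Re (uc * D t) * (1 - 0).
  apply: (@MVT_segment R (fun t => Re (phi t)) (fun t => Re (uc * D t))) => //.
    move=> t; rewrite in_itv /= => /andP[t0 t1]; apply: dRC_Re; apply: dphi.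
    by rewrite !ltW.
  apply: derivable_within_continuous => t; rewrite in_itv /= => t01.
  by have [] := dRC_Re (dphi t t01).
have p1 : p 1 = z by rewrite /p scale1r addrC subrK.
have p0 : p 0 = z' by rewrite /p scale0r addr0.
have E1 : Re (phi 1) - Re (phi 0) = cmod u ^+ 2.
  rewrite cmodE sqr_sqrtr ?addr_ge0 ?sqr_ge0 //.
  rewrite -ReCN -ReCD /phi p1 p0.
  have -> : uc * (f z - 1%:C * S) - uc * (f z' - 0%:C * S) = uc * u.
    by rewrite /u (_ : (0%:C : C) = 0) // (_ : (1%:C : C) = 1) //; ring.
  by rewrite ReCM /=; ring.
have ucu : cmod uc = cmod u by rewrite !cmodE /= sqrrN.
have Dt : cmod (D t) <= c * nrm1 (z - z').
  apply: le_trans (cmod_sum _ _ _) _; rewrite mulr_sumr.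
  apply: ler_sum => j _; rewrite cmodM mulrC !mxE ler_wpM2r ?cmod_ge0 //.
  by move: t01; rewrite in_itv /= => /H[_]; exact.
have [u0|u0] := eqVneq (cmod u) 0.
  by rewrite -/S -/u u0 (le_trans (cmod_ge0 _) Dt).
have up : 0 < cmod u by rewrite lt_def u0 cmod_ge0.
rewrite -/S -/u -(ler_pM2l up) -expr2 -E1 E subr0 mulr1.
apply: le_trans (ler_norm _) _; apply: le_trans (Re_le_cmod _) _.
by rewrite cmodM ucu ler_wpM2l // ltW.
Qed.

(** Strict differentiability: both points move while the derivative stays frozen at [y]. This is
    what makes Newton's map a contraction; balls being convex, the mean value inequality on segments
    applies. *)
Lemma C1_on_strong d (W : set 'rV[C]_d) (f : 'rV[C]_d -> C) (y : 'rV[C]_d) (e : R) :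
  open W -> C1_on W f -> W y -> 0 < e ->
  exists2 r : R, 0 < r & forall z z', nrm1 (z - y) < r -> nrm1 (z' - y) < r ->
  cmod (f z - f z' - \sum_j (z 0 j - z' 0 j) * 'D_(delta_mx 0 j) f y)
    <= e * nrm1 (z - z').
Proof.
move=> oW [df cf] Wy e0.
have nW : nbhs y W by exact: open_nbhs_nbhs.
have nD : nbhs y (fun x => forall j,
    cmod ('D_(delta_mx 0 j) f x - 'D_(delta_mx 0 j) f y) <= e).
  apply: (filter_forall (F := nbhs y)) => j.
  have /(@cvg_cplxP R _ (nbhs y) _) /(_ e e0) := cf j y Wy.
  by apply: filterS => x hx; rewrite cmodB; exact: ltW hx.
have : nbhs y (fun x => W x /\ forall j,
    cmod ('D_(delta_mx 0 j) f x - 'D_(delta_mx 0 j) f y) <= e).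
  exact: (@filterI _ (nbhs y) _ _ _ nW nD).
move=> /nbhs_rVP[r r0 rP]; exists r => // z z' zr z'r.
apply: segment_mean_value => t /andP[t0 t1] x.
have /rP[Wx Dx] : nrm1 (x - y) < r.
  have -> : x - y = (t%:C : C) *: (z - y) + ((1 - t)%:C : C) *: (z' - y).
    have -> : ((1 - t)%:C : C) = 1 - t%:C by apply: complex_eqP; rewrite /= ?subr0.
    exact: segment_combination.
  apply: le_lt_trans (nrm1D _ _) _; rewrite !nrm1Z !cmodC !ger0_norm ?subr_ge0 //.
  have [t0'|t0'] := eqVneq t 0; first by rewrite t0' mul0r add0r subr0 mul1r.
  have tp : 0 < t by rewrite lt_def t0' t0.
  have -> : r = t * r + (1 - t) * r by ring.
  by rewrite ltr_leD // ?ltr_pM2l // ler_wpM2l ?subr_ge0 // ltW.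
by split => //; exact: df.
Qed.

End ComplexDifferential.

(** * Operations on C^1 functions *)

Lemma continuous_on_eq (T U : topologicalType) (W : set T) (f g : T -> U) (x : T) :
  open W -> W x -> (forall y, W y -> f y = g y) -> {for x, continuous g} ->
  {for x, continuous f}.
Proof.
move=> oW Wx fg cg; rewrite /prop_for /continuous_at fg //.
apply: cvg_trans cg; apply: near_eq_cvg.
have : nbhs x W by exact: open_nbhs_nbhs.
by apply: filterS => y /fg.
Qed.

Lemma funalg_C1_on (K : numFieldType) (d : nat) (W : set 'rV[K]_d) :
  open W -> funalg (C1_on W).
Proof.
move=> oW; split=> [c|f g [df cf] [dg cg]|f g [df cf] [dg cg]]; split=> [z Wz|j z Wz].
- exact: differentiable_cst.
- rewrite (_ : 'D_(delta_mx 0 j) (fun=> c) = fun=> 0); last first.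
    apply/funext => y; exact: (@derive_cst K 'rV[K]_d K^o c y).
  by have [cc _ _] := @funalg_continuous K 'rV[K]_d z; exact: cc.
- exact: (differentiableD (df z Wz) (dg z Wz)).
- apply: (continuous_on_eq (g := fun y =>
    'D_(delta_mx 0 j) f y + 'D_(delta_mx 0 j) g y) oW Wz) => [y Wy|].
    exact: (deriveD (diff_derivable (df y Wy)) (diff_derivable (dg y Wy))).
  have [_ cD _] := @funalg_continuous K 'rV[K]_d z.
  exact: (cD _ _ (cf j z Wz) (cg j z Wz)).
- exact: (differentiableM (df z Wz) (dg z Wz)).
- apply: (continuous_on_eq (g := fun y =>
    f y * 'D_(delta_mx 0 j) g y + g y * 'D_(delta_mx 0 j) f y) oW Wz) => [y Wy|].
    exact: (deriveM (diff_derivable (df y Wy)) (diff_derivable (dg y Wy))).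
  have [_ cD cM] := @funalg_continuous K 'rV[K]_d z.
  have cfz := differentiable_continuous (df z Wz).
  have cgz := differentiable_continuous (dg z Wz).
  exact: (cD _ _ (cM _ _ cfz (cg j z Wz)) (cM _ _ cgz (cf j z Wz))).
Qed.

Lemma C1_on_subset (K : numFieldType) (d : nat) (W V : set 'rV[K]_d) f :
  V `<=` W -> C1_on W f -> C1_on V f.
Proof. by move=> VW [df cf]; split=> [z /VW|j z /VW]; [exact: df|exact: cf]. Qed.

Section InverseFunction.
Variable R : realType.
Local Notation C := (Cplx R).

Definition entrysum m n (M : 'M[C]_(m, n)) : R := \sum_i \sum_j cmod (M i j).

Lemma entrysum_ge0 m n (M : 'M[C]_(m, n)) : 0 <= entrysum M.
Proof. by do 2![apply: sumr_ge0 => ? _]; exact: cmod_ge0. Qed.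

Lemma nrm1_mulmx m n (x : 'rV[C]_m) (M : 'M[C]_(m, n)) :
  nrm1 (x *m M) <= entrysum M * nrm1 x.
Proof.
rewrite /entrysum exchange_big /= mulr_suml; apply: ler_sum => j _.
rewrite mxE; apply: le_trans (cmod_sum _ _ _) _.
rewrite mulr_suml; apply: ler_sum => i _.
by rewrite cmodM mulrC ler_wpM2l ?cmod_ge0 // cmod_le_nrm1.
Qed.

Lemma open_nrm1_ball d (z : 'rV[C]_d) (r : R) : open [set y | nrm1 (y - z) < r].
Proof.
rewrite openE => y /= yz; apply/nbhs_rVP.
exists (r - nrm1 (y - z)); first by rewrite subr_gt0.
move=> x xy; apply: le_lt_trans (nrm1_triangle x y z) _.
by rewrite -ltrBrDr.
Qed.

Lemma continuous_rV (T : topologicalType) d (G : T -> 'rV[C]_d) (x : T) :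
  (forall j, {for x, continuous (fun t => G t 0 j)}) -> {for x, continuous G}.
Proof.
move=> h; apply/(@cvg_rVP R d _ (nbhs x) _) => e e0.
have e1 : 0 < e / d.+1%:R by rewrite divr_gt0.
have : nbhs x (fun t => forall j, cmod (G t 0 j - G x 0 j) < e / d.+1%:R).
  apply: (filter_forall (F := nbhs x)) => j.
  have /(@cvg_cplxP R _ (nbhs x) _) /(_ _ e1) := h j.
  by apply: filterS => t; rewrite cmodB.
apply: filterS => t ht.
apply: (@le_lt_trans _ _ (\sum_(j < d) e / d.+1%:R)).
  by apply: ler_sum => j _; rewrite !mxE ltW.
rewrite sumr_const card_ord -(mulr_natr (e / _)) -mulrA gtr_pMr // mulrC.
by rewrite ltr_pdivrMr // mul1r ltr_nat.
Qed.

Lemma expands_comp_rV m d (G : 'rV[C]_m -> 'rV[C]_d) (f : 'rV[C]_d -> C)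
    (x : 'rV[C]_m) (b : 'I_d -> 'I_m -> C) (a : 'I_d -> C) :
  (forall j, expands (fun y => G y 0 j) x (b j)) -> expands f (G x) a ->
  expands (fun y => f (G y)) x (fun k => \sum_j b j k * a j).
Proof.
move=> Gb fa; apply/expandsP => e e0.
pose B := \sum_j \sum_k cmod (b j k).
have B0 : 0 <= B by do 2![apply: sumr_ge0 => ? _]; exact: cmod_ge0.
have s0 : (fun y => nrm1 (y - x)) @ nbhs x --> (0 : R).
  apply/(@cvgrPdist_lt R R^o _ (nbhs x) _) => e1 e10.
  apply/nbhs_rVP; exists e1 => // y.
  by rewrite sub0r normrN ger0_norm // nrm1_ge0.
have H := @expands_comp R d _ (nbhs x) _ (fun y => nrm1 (y - x)) G (G x)
  (fun j y => \sum_k (y 0 k - x 0 k) * b j k) B f a B0 _ s0 _ _ fa e e0.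
have : nbhs x (fun y => cmod (f (G y) - f (G x) -
    \sum_j (\sum_k (y 0 k - x 0 k) * b j k) * a j) <= e * nrm1 (y - x)).
  apply: H => [s|j s|j e1 e10]; first exact: nrm1_ge0.
    apply: le_trans (cmod_sum _ _ _) _.
    apply: (@le_trans _ _ ((\sum_k cmod (b j k)) * nrm1 (s - x))).
      rewrite mulr_suml; apply: ler_sum => k _; rewrite cmodM mulrC.
      rewrite ler_wpM2l ?cmod_ge0 // (le_trans _ (cmod_le_nrm1 _ k)) //.
      by rewrite !mxE.
    rewrite ler_wpM2r ?nrm1_ge0 // /B (bigD1 j) //= lerDl.
    by do 2![apply: sumr_ge0 => ? _]; exact: cmod_ge0.
  by have /expandsP := Gb j; exact.
apply: filterS => y.
rewrite (_ : \sum_j (\sum_k (y 0 k - x 0 k) * b j k) * a j =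
  \sum_k (y 0 k - x 0 k) * \sum_j b j k * a j) //.
under eq_bigr do rewrite mulr_suml; rewrite exchange_big /=.
by apply: eq_bigr => k _; rewrite mulr_sumr; apply: eq_bigr => j _; rewrite mulrA.
Qed.

Lemma C1_on_continuous d (W : set 'rV[C]_d) (f : 'rV[C]_d -> C) z :
  C1_on W f -> W z -> {for z, continuous f}.
Proof. by move=> [df _] Wz; exact: differentiable_continuous (df z Wz). Qed.

Lemma C1_on_comp m d (B : set 'rV[C]_m) (W : set 'rV[C]_d)
    (G : 'rV[C]_m -> 'rV[C]_d) (f : 'rV[C]_d -> C) :
  open B -> (forall j, C1_on B (fun y => G y 0 j)) ->
  (forall x, B x -> W (G x)) -> C1_on W f ->
  C1_on B (fun y => f (G y)) /\
  forall x, B x -> forall k, 'D_(delta_mx 0 k) (fun y => f (G y)) x =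
    \sum_j 'D_(delta_mx 0 k) (fun y => G y 0 j) x * 'D_(delta_mx 0 j) f (G x).
Proof.
move=> oB GB BW fW.
have E x : B x -> expands (fun y => f (G y)) x (fun k => \sum_j
   'D_(delta_mx 0 k) (fun y => G y 0 j) x * 'D_(delta_mx 0 j) f (G x)).
  move=> Bx; apply: (@expands_comp_rV _ _ G f x
    (fun j k => 'D_(delta_mx 0 k) (fun y => G y 0 j) x)
    (fun j => 'D_(delta_mx 0 j) f (G x))).
    by move=> j; apply: differentiable_expands; exact: (GB j).1.
  by apply: differentiable_expands; apply: fW.1; exact: BW.
have cG x : B x -> {for x, continuous G}.
  by move=> Bx; apply: continuous_rV => j; exact: C1_on_continuous (GB j) Bx.
split; last by move=> x /E /expands_differentiable[].
split=> [x /E /expands_differentiable[]//|k x Bx].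
apply: (continuous_on_eq (g := fun x => \sum_j
   'D_(delta_mx 0 k) (fun y => G y 0 j) x * 'D_(delta_mx 0 j) f (G x)) oB Bx).
  by move=> y /E /expands_differentiable[].
have [_ _ cM] := @funalg_continuous C 'rV[C]_m x.
have H := @funalg_sum _ _ _ (@funalg_continuous C 'rV[C]_m x) _ (index_enum 'I_d)
  xpredT (fun j x => 'D_(delta_mx 0 k) (fun y => G y 0 j) x *
    'D_(delta_mx 0 j) f (G x)).
apply: H => j _; apply: cM; first exact: (GB j).2.
exact: (@continuous_comp _ _ _ G ('D_(delta_mx 0 j) f) x (cG x Bx)
  (fW.2 j _ (BW x Bx))).
Qed.

End InverseFunction.

(** * The inverse function theorem *)

Lemma mulmxV_tr (K : fieldType) d (A : 'M[K]_d) :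
  \det A != 0 -> A^T *m invmx A^T = 1%:M.
Proof. by move=> A0; rewrite mulmxV // unitmx_tr unitmxE unitfE. Qed.

Section RealEstimates.
Variable F : realFieldType.
Implicit Types a b c r : F.

Lemma le_half_sub a b c : a <= 2^-1 * c -> c <= a + b -> c <= 2 * b.
Proof. by move=> h h'; lra. Qed.

Lemma half_quarter_le a b c r : 0 < r -> c <= r -> b <= r / 4 -> a <= 2^-1 * c -> a + b <= r.
Proof. by move=> r0 h h' h''; lra. Qed.

Lemma le_half_le0 a b : b <= 2^-1 * a -> a <= b -> a <= 0.
Proof. by move=> h h'; lra. Qed.

Lemma double_quarter_lt a b r : 0 < r -> a <= r / 4 -> b <= 2 * a -> b < r.
Proof. by move=> r0 h h'; lra. Qed.

End RealEstimates.

Section InverseFunctionTheorem.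
Variable R : realType.
Local Notation C := (Cplx R).

Lemma near_continuous_neq0 (T : topologicalType) (f : T -> C) (x : T) :
  {for x, continuous f} -> f x != 0 -> nbhs x (fun y => f y != 0).
Proof.
move=> cf; rewrite -cmod_gt0 => f0.
have /(@cvg_cplxP R _ (nbhs x) _) /(_ _ f0) := cf.
apply: filterS => y hy; apply/negP => /eqP fy.
by move: hy; rewrite fy subr0 ltxx.
Qed.

(** One row per component, as in [jac_det_system]. On row vectors the differential is therefore
    right multiplication by the transpose, whence the transposes below. *)
Definition jacobian_mx d (p : 'rV[C]_d -> 'rV[C]_d) (z : 'rV[C]_d) : 'M[C]_d :=
  \matrix_(i, j) 'D_(delta_mx 0 j) (fun y => p y 0 i) z.

Lemma mulmx_step (K : comPzRingType) d (u v w : 'rV[K]_d) (A B : 'M[K]_d) :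
  A *m B = 1%:M -> (u - v *m A) *m B = u *m B - v.
Proof. by move=> AB; rewrite mulmxBl -mulmxA AB mulmx1. Qed.

(** Displacement of a Newton step from [z0]: the first bracket is the error bounded in
    [local_contraction], the second term measures how far the target [x] is from [p z0]. *)
Lemma newton_increment (K : comPzRingType) d (z z0 pz p0 x : 'rV[K]_d) (B : 'M[K]_d) :
  z - (pz - x) *m B - z0 =
  - ((pz - p0) *m B - (z - z0)) + (x - p0) *m B.
Proof.
rewrite !mulmxBl !opprB; apply/rowP => j; rewrite !mxE.
set a := \sum_(_ < _) _; set b := \sum_(_ < _) _; set c := \sum_(_ < _) _.
by ring.
Qed.

(** As the step itself is minus the old residual, the new residual is exactly the contraction error
    between the two iterates. *)
Lemma newton_value (K : comPzRingType) d (z p2 pz x : 'rV[K]_d) (B : 'M[K]_d) :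
  (p2 - x) *m B = (p2 - pz) *m B - (z - (pz - x) *m B - z).
Proof.
rewrite !mulmxBl; apply/rowP => j; rewrite !mxE.
set a := \sum_(_ < _) _; set b := \sum_(_ < _) _; set c := \sum_(_ < _) _.
by ring.
Qed.

Section LocalInverse.
Variables (d : nat) (W : set 'rV[C]_d) (p : 'rV[C]_d -> 'rV[C]_d) (z0 : 'rV[C]_d).
Hypothesis oW : open W.
Hypothesis pW : forall i, C1_on W (fun z => p z 0 i).
Hypothesis Wz0 : W z0.
Hypothesis J0 : \det (jacobian_mx p z0) != 0.

Lemma jacobian_expand (y : 'rV[C]_d) (e : R) : W y -> 0 < e ->
  exists2 r : R, 0 < r & forall z z', nrm1 (z - y) < r -> nrm1 (z' - y) < r ->
  nrm1 (p z - p z' - (z - z') *m (jacobian_mx p y)^T) <= e * nrm1 (z - z').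
Proof.
move=> Wy e0; have e1 : 0 < e / d.+1%:R by rewrite divr_gt0.
have H i := C1_on_strong oW (pW i) Wy e1.
have : nbhs y (fun x => W x) by exact: open_nbhs_nbhs.
have /choice[r rP] : forall i : 'I_d, exists r : R, 0 < r /\ forall z z',
    nrm1 (z - y) < r -> nrm1 (z' - y) < r ->
    cmod (p z 0 i - p z' 0 i - \sum_j (z 0 j - z' 0 j) *
      'D_(delta_mx 0 j) (fun z => p z 0 i) y) <= e / d.+1%:R * nrm1 (z - z').
  by move=> i; have [r r0 h] := H i; exists r.
move=> _.
(* The seed 1 of the minimum keeps the radius positive when [d] is 0. *)
have [r1 [r10 r1P]] : exists r1 : R, 0 < r1 /\ forall i, r1 <= r i.
  exists (\big[Num.min/1]_i r i); split.
    by elim/big_ind : _ => // [a b a0 b0|i _]; [rewrite lt_min a0|exact: (rP i).1].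
  by move=> i; rewrite bigmin_le.
exists r1 => // z z' zr z'r.
apply: (@le_trans _ _ (\sum_(i < d) e / d.+1%:R * nrm1 (z - z'))).
  apply: ler_sum => i _; rewrite !mxE.
  have := (rP i).2 z z' (lt_le_trans zr (r1P i)) (lt_le_trans z'r (r1P i)).
  apply: le_trans; rewrite le_eqVlt; apply/orP; left; apply/eqP; congr (cmod (_ - _)).
  by apply: eq_bigr => j _; rewrite !mxE.
rewrite sumr_const card_ord -(mulr_natl (_ * _)) mulrA ler_wpM2r ?nrm1_ge0 //.
by rewrite mulrCA ler_piMr ?(ltW e0) // ler_pdivrMr // mul1r ler_nat.
Qed.

Lemma jacobian_continuous y i j : W y ->
  {for y, continuous (fun z => jacobian_mx p z i j)}.
Proof.
move=> Wy; rewrite (_ : (fun z => jacobian_mx p z i j) =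
  'D_(delta_mx 0 j) (fun z => p z 0 i)); first exact: (pW i).2.
by apply/funext => z; rewrite mxE.
Qed.

Lemma local_contraction : exists r0 : R, [/\ 0 < r0,
    forall z, nrm1 (z - z0) < r0 -> W z /\ \det (jacobian_mx p z) != 0 &
    forall z z', nrm1 (z - z0) < r0 -> nrm1 (z' - z0) < r0 ->
    nrm1 ((p z - p z') *m (invmx (jacobian_mx p z0)^T) - (z - z')) <=
      2^-1 * nrm1 (z - z')].
Proof.
set A := (jacobian_mx p z0)^T; set B := invmx A.
have AB : A *m B = 1%:M by exact: mulmxV_tr.
(* Multiplication by [B] costs at most [entrysum B]; an expansion error below the inverse of this
   number then leaves the contraction factor 1/2. *)
have N0 : 0 < 2 * (entrysum B + 1).
  by rewrite mulr_gt0 // ltr_wpDl // entrysum_ge0.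
have N1 : 0 < (2 * (entrysum B + 1))^-1 by rewrite invr_gt0.
have [r1 r10 r1P] := jacobian_expand Wz0 N1.
have nW : nbhs z0 W by exact: open_nbhs_nbhs.
have cJ : {for z0, continuous (fun z => \det (jacobian_mx p z))}.
  have H := @funalg_det _ _ _ (@funalg_continuous C 'rV[C]_d z0) d (jacobian_mx p).
  apply: H => i j.
  exact: jacobian_continuous.
have nJ : nbhs z0 (fun z => \det (jacobian_mx p z) != 0).
  exact: (near_continuous_neq0 cJ J0).
have : nbhs z0 (fun z => W z /\ \det (jacobian_mx p z) != 0).
  exact: (@filterI _ (nbhs z0) _ _ _ nW nJ).
move=> /nbhs_rVP[r2 r20 r2P].
exists (Num.min r1 r2); split; first by rewrite lt_min r10 r20.
  by move=> z; rewrite lt_min => /andP[_ /r2P].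
move=> z z'; rewrite !lt_min => /andP[zr _] /andP[z'r _].
have := r1P z z' zr z'r.
rewrite -(@mulmx_step _ _ _ _ 0 A B) // => h.
apply: le_trans (nrm1_mulmx _ _) _.
apply: le_trans (ler_wpM2l (entrysum_ge0 _) h) _.
rewrite mulrA ler_wpM2r ?nrm1_ge0 // ler_pdivrMr //.
by rewrite mulrA mulVf // mul1r lerDl.
Qed.

Lemma inverse_lipschitz (r0 : R) : 
  (forall z z', nrm1 (z - z0) < r0 -> nrm1 (z' - z0) < r0 ->
    nrm1 ((p z - p z') *m (invmx (jacobian_mx p z0)^T) - (z - z')) <=
      2^-1 * nrm1 (z - z')) ->
  forall z z', nrm1 (z - z0) < r0 -> nrm1 (z' - z0) < r0 ->
    nrm1 (z - z') <= 2 * nrm1 ((p z - p z') *m (invmx (jacobian_mx p z0)^T)).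
Proof.
move=> H z z' zr z'r; have := H z z' zr z'r.
set q := _ *m _; rewrite nrm1B => h.
have := nrm1D (z - z' - q) q; rewrite subrK => h'.
exact: le_half_sub h h'.
Qed.

(* Newton's step at a minimizer of the residual would halve the residual, so
   that compactness of balls replaces a fixed point argument. *)
Lemma local_surjection (r0 r : R) : 0 < r -> r < r0 ->
  (forall z, nrm1 (z - z0) < r0 -> W z) ->
  (forall z z', nrm1 (z - z0) < r0 -> nrm1 (z' - z0) < r0 ->
    nrm1 ((p z - p z') *m (invmx (jacobian_mx p z0)^T) - (z - z')) <=
      2^-1 * nrm1 (z - z')) ->
  forall x, nrm1 ((x - p z0) *m (invmx (jacobian_mx p z0)^T)) <= r / 4 ->
  exists2 z, nrm1 (z - z0) < r & p z = x.
Proof.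
set A := (jacobian_mx p z0)^T; set B := invmx A.
move=> r_gt0 rr0 rW H x xr.
have BA : B *m A = 1%:M by apply: mulmx1C; exact: mulmxV_tr.
pose m z := nrm1 ((p z - x) *m B).
have m_cont z : W z -> {for z, continuous m}.
  move=> Wz.
  have cp : {for z, continuous (fun z => (p z - x) *m B)}.
    apply: continuous_rV => j.
    have [cc cD cM] := @funalg_continuous C 'rV[C]_d z.
    have h := @funalg_sum _ _ _ (@funalg_continuous C 'rV[C]_d z) _ (index_enum 'I_d)
      xpredT (fun k y => (p y 0 k + - x 0 k) * B k j).
    rewrite (_ : (fun t => _) = fun y => \sum_k (p y 0 k + - x 0 k) * B k j); last first.
      by apply/funext => y; rewrite mxE; apply: eq_bigr => k _; rewrite !mxE.
    apply: h => k _; apply: cM; last exact: cc.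
    by apply: cD; [exact: C1_on_continuous (pW k) Wz|exact: cc].
  have cn : {for (p z - x) *m B, continuous (@nrm1 R d)}.
    exact: nrm1_continuous.
  have h := @continuous_comp _ _ _ _ _ z cp cn.
  exact: h.
pose K := [set z | nrm1 (z - z0) <= r].
have K0 : K z0 by rewrite /K /= subrr nrm1_0 ltW.
have [z1 z1K z1min] : exists2 c, c \in K & forall t, t \in K -> m c <= m t.
  apply: compact_EVT_min; first by exists z0.
    exact: compact_nrm1_ball.
  apply: continuous_in_subspaceT => z; rewrite inE => zK.
  by apply: m_cont; apply: rW; exact: le_lt_trans zK rr0.
have {}z1K : nrm1 (z1 - z0) <= r by move: z1K; rewrite inE.
pose z2 := z1 - (p z1 - x) *m B.
have z1r := le_lt_trans z1K rr0.
have z0r : nrm1 (z0 - z0) < r0 by rewrite subrr nrm1_0 (lt_trans r_gt0).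
have z2K : nrm1 (z2 - z0) <= r.
  rewrite /z2 (newton_increment z1 z0 (p z1) (p z0) x B).
  apply: le_trans (nrm1D _ _) _; rewrite nrm1N.
  have := H z1 z0 z1r z0r; rewrite -/A -/B.
  exact: half_quarter_le r_gt0 z1K xr.
have z2r := le_lt_trans z2K rr0.
have m2 : m z2 <= 2^-1 * m z1.
  have := H z2 z1 z2r z1r; rewrite -/A -/B.
  have -> : nrm1 (z2 - z1) = m z1.
    by rewrite /z2 addrAC subrr add0r nrm1N.
  by rewrite /m (newton_value z1 (p z2) (p z1) x B).
have m12 : m z1 <= m z2 by apply: z1min; rewrite inE.
have m1 : m z1 = 0.
  by apply/eqP; rewrite eq_le nrm1_ge0 andbT (le_half_le0 m2).
have pz1 : p z1 = x.
  apply/eqP; rewrite -subr_eq0; apply/eqP.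
  by rewrite -[LHS]mulmx1 -BA mulmxA (nrm1_eq0 m1) mul0mx.
exists z1 => //.
(* The minimizer is so far only in the closed ball; since its image is [x], the Lipschitz bound
   brings it within [r / 2] of [z0]. *)
have := inverse_lipschitz H z1r z0r; rewrite pz1 -/A -/B.
exact: double_quarter_lt r_gt0 xr.
Qed.

Lemma local_inverse_exists (V : set 'rV[C]_d) : nbhs z0 V ->
  exists r rho L : R, exists G : 'rV[C]_d -> 'rV[C]_d,
  [/\ 0 < r, 0 < rho & 0 < L] /\
  [/\ forall z, nrm1 (z - z0) < r ->
        [/\ V z, W z & \det (jacobian_mx p z) != 0],
      forall z z', nrm1 (z - z0) < r -> nrm1 (z' - z0) < r -> p z = p z' -> z = z',
      forall x, nrm1 (x - p z0) < rho -> nrm1 (G x - z0) < r /\ p (G x) = x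
    & forall x x', nrm1 (x - p z0) < rho -> nrm1 (x' - p z0) < rho ->
        nrm1 (G x - G x') <= L * nrm1 (x - x')].
Proof.
move=> /nbhs_rVP[rV rV0 rVP].
have [r0 [r00 r0W H]] := local_contraction.
have lip := inverse_lipschitz H.
set B := invmx (jacobian_mx p z0)^T in H lip.
(* Halving keeps the closed ball of radius [r], on which the residual is minimized, inside the ball
   of the contraction estimate. *)
pose r := Num.min (r0 / 2) rV.
have r_gt0 : 0 < r by rewrite lt_min rV0 divr_gt0.
have rr0 : r < r0 by rewrite gt_min ltr_pdivrMr // ltr_pMr // ltr1n.
pose N := entrysum B + 1.
have N0 : 0 < N by rewrite ltr_wpDl // entrysum_ge0.
have surj x : nrm1 (x - p z0) < r / 4 / N -> exists z, nrm1 (z - z0) < r /\ p z = x.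
  move=> xr.
  have [||z zr pz] := @local_surjection r0 r r_gt0 rr0 _ H x.
  - by move=> z /r0W[].
  - apply: le_trans (nrm1_mulmx _ _) _; move: xr; rewrite ltr_pdivlMr // mulrC.
    move=> xr; apply: le_trans (ltW xr).
    by rewrite ler_wpM2r ?nrm1_ge0 // lerDl.
  by exists z.
(* [G] is chosen on the whole space; outside the ball of surjectivity nothing is required of its
   values. *)
have /choice[G GP] : forall x, exists z, nrm1 (x - p z0) < r / 4 / N ->
    nrm1 (z - z0) < r /\ p z = x.
  move=> x; have [xr|xr] := boolP (nrm1 (x - p z0) < r / 4 / N).
    by have [z h] := surj x xr; exists z.
  by exists z0.
have lipN z z' : nrm1 (z - z0) < r -> nrm1 (z' - z0) < r ->
    nrm1 (z - z') <= 2 * N * nrm1 (p z - p z').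
  move=> zr z'r.
  apply: le_trans (lip _ _ (lt_trans zr rr0) (lt_trans z'r rr0)) _.
  rewrite -mulrA ler_wpM2l //; apply: le_trans (nrm1_mulmx _ _) _.
  by rewrite ler_wpM2r ?nrm1_ge0 // lerDl.
exists r, (r / 4 / N), (2 * N), G; split; first by rewrite !divr_gt0 ?mulr_gt0.
split=> [z zr|z z' zr z'r pp|x /GP//|x x' /GP[a b] /GP[a' b']].
- have [Wz Jz] := r0W z (lt_trans zr rr0); split=> //.
  by apply: rVP; apply: lt_le_trans zr _; rewrite ge_min lexx orbT.
- have := lipN z z' zr z'r; rewrite pp subrr nrm1_0 mulr0 => h.
  apply/eqP; rewrite -subr_eq0; apply/eqP; apply: nrm1_eq0.
  by apply/eqP; rewrite eq_le h nrm1_ge0.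
by have := lipN _ _ a a'; rewrite b b'.
Qed.

Section Inverse.
Variables (r rho L : R) (G : 'rV[C]_d -> 'rV[C]_d).
Hypothesis L_gt0 : 0 < L.
Hypothesis rW : forall z, nrm1 (z - z0) < r -> W z /\ \det (jacobian_mx p z) != 0.
Hypothesis GP : forall x, nrm1 (x - p z0) < rho -> nrm1 (G x - z0) < r /\ p (G x) = x.
Hypothesis GL : forall x x', nrm1 (x - p z0) < rho -> nrm1 (x' - p z0) < rho ->
  nrm1 (G x - G x') <= L * nrm1 (x - x').

Local Notation B := [set x : 'rV[C]_d | nrm1 (x - p z0) < rho].

Lemma inverse_continuous x : B x -> {for x, continuous G}.
Proof.
move=> Bx; apply/(@cvg_rVP R d _ (nbhs x) _) => e e0.
have nB : nbhs x B by apply: open_nbhs_nbhs; split=> //; exact: open_nrm1_ball.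
have e1 : 0 < e / L by rewrite divr_gt0.
have ne : nbhs x (fun y => nrm1 (y - x) < e / L) by apply/nbhs_rVP; exists (e / L).
apply: filterS2 nB ne => y By; rewrite ltr_pdivlMr // mulrC.
by apply: le_lt_trans; exact: GL.
Qed.

(** The expansion of [p] at [G x] is multiplied by the inverse Jacobian, at cost [N]. The Lipschitz
    bound then converts an error relative to the increment of [G] into one relative to [y - x], at
    cost [L]. *)
Lemma inverse_expands x j : B x ->
  expands (fun y => G y 0 j) x (fun k => invmx (jacobian_mx p (G x)) j k).
Proof.
move=> Bx; apply/expandsP => e e0.
have [Gr pG] := GP Bx; have [WG JG] := rW Gr.
set J := jacobian_mx p (G x) in JG *.
have JV : J^T *m (invmx J)^T = 1%:M.
  by rewrite -trmx_mul mulVmx ?trmx1 // unitmxE unitfE.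
pose N := entrysum (invmx J)^T + 1.
have N0 : 0 < N by rewrite ltr_wpDl // entrysum_ge0.
have e1 : 0 < e / (N * L) by rewrite divr_gt0 // mulr_gt0.
have [s s0 sP] := jacobian_expand WG e1.
have nB : nbhs x B by apply: open_nbhs_nbhs; split=> //; exact: open_nrm1_ball.
have nG : nbhs x (fun y => nrm1 (G y - G x) < s).
  have /(@cvg_rVP R d _ (nbhs x) _) := inverse_continuous Bx; exact.
apply: filterS2 nB nG => y By Gy.
have [_ pGy] := GP By.
have Gxx : nrm1 (G x - G x) < s by rewrite subrr nrm1_0.
have := sP (G y) (G x) Gy Gxx; rewrite pGy pG -/J.
rewrite -[X in X <= _](@nrm1N R d) opprB => h.
have E : (G y - G x) - (y - x) *m (invmx J)^T =
    ((G y - G x) *m J^T - (y - x)) *m (invmx J)^T.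
  by rewrite [RHS]mulmxBl -mulmxA JV mulmx1.
have -> : G y 0 j - G x 0 j - \sum_k (y 0 k - x 0 k) * invmx J j k =
    (((G y - G x) - (y - x) *m (invmx J)^T) : 'rV[C]_d) 0 j.
  rewrite !mxE; congr (_ - _); apply: eq_bigr => k _.
  by rewrite !mxE.
rewrite E; apply: le_trans (cmod_le_nrm1 _ _) _.
apply: le_trans (nrm1_mulmx _ _) _.
apply: (@le_trans _ _ (N * (e / (N * L) * (L * nrm1 (y - x))))).
  apply: ler_pM; rewrite ?entrysum_ge0 ?nrm1_ge0 // ?lerDl //.
  by apply: le_trans h _; rewrite ler_wpM2l ?(ltW e1) // GL.
move: (nrm1 (y - x)) => t; rewrite le_eqVlt; apply/orP; left; apply/eqP.
by field; rewrite !gt_eqF.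
Qed.

Lemma inverse_derive x j k : B x ->
  'D_(delta_mx 0 k) (fun y => G y 0 j) x = invmx (jacobian_mx p (G x)) j k.
Proof. by move=> Bx; have [_] := expands_differentiable (inverse_expands j Bx); exact. Qed.

(** By Cramer's formula the partial derivatives of [G] are adjugate entries over the determinant of
    a Jacobian that depends continuously on the point. *)
Lemma inverse_C1 j : C1_on B (fun y => G y 0 j).
Proof.
have oB : open B by exact: open_nrm1_ball.
split=> [x Bx|k x Bx].
  by have [] := expands_differentiable (inverse_expands j Bx).
apply: (continuous_on_eq (g := fun y => (\det (jacobian_mx p (G y)))^-1 *
    (\adj (jacobian_mx p (G y))) j k) oB Bx).
  move=> y By; rewrite inverse_derive //.
  have [Gr _] := GP By; have [WG JG] := rW Gr.
  by rewrite /invmx unitmxE unitfE JG mxE.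
have [Gr _] := GP Bx; have [WG JG] := rW Gr.
have cG := inverse_continuous Bx.
have cJ a b : {for x, continuous (fun y => jacobian_mx p (G y) a b)}.
  exact: (@continuous_comp _ _ _ G (fun z => jacobian_mx p z a b) x cG
    (jacobian_continuous WG)).
have [_ _ cM] := @funalg_continuous C 'rV[C]_d x.
apply: cM; last first.
  exact: (@funalg_adj _ _ _ (@funalg_continuous C 'rV[C]_d x) d
    (fun y => jacobian_mx p (G y)) cJ).
have cd := @funalg_det _ _ _ (@funalg_continuous C 'rV[C]_d x) d
    (fun y => jacobian_mx p (G y)) cJ.
exact: (@cvgV C _ (nbhs x) _ _ _ JG cd).
Qed.

Lemma inverse_det x : B x ->
  \det (\matrix_(j, k) 'D_(delta_mx 0 k) (fun y => G y 0 j) x : 'M[C]_d) =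
  (\det (jacobian_mx p (G x)))^-1.
Proof.
move=> Bx; rewrite -det_inv; congr (\det _).
by apply/matrixP => j k; rewrite mxE inverse_derive.
Qed.

End Inverse.

End LocalInverse.
End InverseFunctionTheorem.

(** * The mean value property on circles *)

Section PolarMean.
Variable R : realType.
Local Notation mu := (@lebesgue_measure R).

(* [v] plays the role of the harmonic conjugate of [u] in polar coordinates. *)
Lemma polar_mean (u us v : R -> R -> R) (a b rho M : R) : a < b ->
  (forall s t : R, `|s| < rho -> is_derive s 1 (fun x : R => u x t) (us s t)) ->
  (forall s t : R, `|s| < rho -> is_derive t 1 (v s) (s * us s t)) ->
  (forall s, `|s| < rho -> v s a = v s b) ->
  (forall s, `|s| < rho -> continuous (u s)) ->
  (forall s, `|s| < rho -> continuous (us s)) ->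
  (forall s t, `|s| < rho -> `|us s t| <= M) ->
  forall r, 0 <= r < rho ->
  \int[mu]_(t in `[a, b]) u r t = \int[mu]_(t in `[a, b]) u 0 t.
Proof.
move=> ab du dv vab cu cus usM r /andP[r0 rrho].
pose I s := \int[mu]_(t in `[a, b]) u s t.
have int_cont (f : R -> R) : continuous f -> mu.-integrable `[a, b] (EFin \o f).
  move=> cf; apply: continuous_compact_integrable; first exact: segment_compact.
  exact: continuous_subspaceT.
have inI s : s \in `]- rho, rho[%R -> `|s| < rho by rewrite in_itv /= ltr_norml.
have M0 : 0 <= M.
  by apply: le_trans (normr_ge0 (us 0 0)) (usM _ _ _); rewrite normr0 (le_lt_trans r0).
have dI s : `|s| < rho ->
    derivable I s 1 /\ derive1 I s = \int[mu]_(t in `[a, b]) us s t.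
  move=> sI.
  have Is : `]- rho, rho[%classic s by rewrite /= in_itv /= -ltr_norml.
  have intf s' : `]- rho, rho[%classic s' -> mu.-integrable `[a, b] (EFin \o u s').
    by move=> /inI h; apply: int_cont; exact: cu.
  have derf s' t : `]- rho, rho[%classic s' -> `[a, b]%classic t ->
      derivable (u ^~ t) s' 1.
    by move=> /inI h _; have [] := du s' t h.
  have intM : mu.-integrable `[a, b] (EFin \o (fun=> M)).
    by apply: int_cont => x; exact: cvg_cst.
  have ub s' t : `]- rho, rho[%classic s' -> `[a, b]%classic t ->
      `|partial1of2 u s' t| <= M.
    move=> /inI h _; rewrite partial1of2E; have [_ ->] := du s' t h.
    exact: usM.
  have D := @derivable_under_integral R _ _ mu u `[a, b] (measurable_itv _)
    s (- rho) rho Is intf derf (fun=> M) (fun=> M0) intM ub.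
  have E := @differentiation_under_integral R _ _ mu u `[a, b] (measurable_itv _)
    s (- rho) rho Is intf derf (fun=> M) (fun=> M0) intM ub.
  split; first exact: D.
  rewrite E; apply: eq_Rintegral => t _.
  by rewrite partial1of2E; have [_ ->] := du s t sI.
have I'0 s : 0 < s < rho -> is_derive s 1 I 0.
  move=> /andP[s0 srho].
  have sI : `|s| < rho by rewrite gtr0_norm.
  have [D E] := dI s sI.
  split; first exact: D.
  rewrite -derive1E E.
  (* After multiplication by [s] the integrand is the [t]-derivative of [v s], so the integral is
     [v s b - v s a = 0]. *)
  apply: (mulfI (lt0r_neq0 s0)); rewrite mulr0 -RintegralZl //; last first.
    by apply: int_cont; exact: cus.
  have csus : continuous (fun t => s * us s t).
    move=> t; have [cc _ cM] := @funalg_continuous R R t.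
    exact: (cM _ _ (cc s) (cus s sI t)).
  have cv : continuous (v s).
    by move=> t; apply: differentiable_continuous; apply/derivable1_diffP; have [] := dv s t sI.
  rewrite /Rintegral (@continuous_FTC2 R _ (v s)) //.
  - by rewrite -EFinB /= vab // subrr.
  - exact: continuous_subspaceT.
  - split=> [t _||]; first by have [] := dv s t sI.
      exact: cvg_at_right_filter (cv a).
    exact: cvg_at_left_filter (cv b).
  by move=> t _; rewrite derive1E; have [_ ->] := dv s t sI.
(* Division by [s] is impossible at 0, but there only continuity of [I] is asked for; it follows
   from [dI], whose hypotheses hold on both sides of 0. *)
have [||c _] := @MVT_segment R I (fun=> 0) 0 r r0.
- move=> s; rewrite in_itv /= => /andP[s0 sr]; apply: I'0.
  by rewrite s0 (lt_trans sr).
- apply: derivable_within_continuous => s; rewrite in_itv /= => /andP[s0 sr].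
  by have [] := dI s; rewrite ?ger0_norm // (le_lt_trans sr).
by rewrite mul0r => /eqP; rewrite subr_eq0 => /eqP.
Qed.

End PolarMean.

Lemma line_coord (K : comPzRingType) d (x : 'rV[K]_d) (a b c h : K) j k :
  (x + a *: delta_mx 0 k) 0 j - (x + b *: delta_mx 0 k) 0 j -
  (c * (j == k)%:R) * h = (a - b - c * h) * (j == k)%:R.
Proof. by rewrite !mxE eqxx /=; ring. Qed.

Lemma line_coordE (K : pzRingType) d (x : 'rV[K]_d) (c : K) j k :
  (x + c *: delta_mx 0 k) 0 j = x 0 j + c * (j == k)%:R.
Proof. by rewrite !mxE eqxx. Qed.

Section CircleMean.
Variable R : realType.
Local Notation C := (Cplx R).
Local Notation Re := (@complex.Re R).
Local Notation Im := (@complex.Im R).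
Local Notation mu := (@lebesgue_measure R).

Definition cis (t : R) : C := cos t +i* sin t.

Definition polydisc d (rho : R) : set 'rV[C]_d :=
  [set x | forall j, cmod (x 0 j) < rho].

Lemma cmod_cis t : cmod (cis t) = 1.
Proof. by rewrite cmodE /= cos2Dsin2 sqrtr1. Qed.

Lemma cmod_real_cis (s t : R) : cmod ((s%:C : C) * cis t) = `|s|.
Proof. by rewrite cmodM cmodC cmod_cis mulr1. Qed.

Lemma dRC_cis (s t : R) :
  dRC (fun t => (s%:C : C) * cis t) t ((s%:C : C) * (- sin t +i* cos t)).
Proof.
have h : dRC cis t (- sin t +i* cos t) by apply: dRC_complex.
move=> e e0.
have e1 : 0 < e / (`|s| + 1) by rewrite divr_gt0 // ltr_wpDl.
move: (h _ e1); apply: filterS => y hy.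
rewrite -mulrBr -mulrA -mulrBr cmodM cmodC.
apply: le_trans (ler_wpM2l (normr_ge0 s) hy) _.
rewrite mulrA ler_wpM2r // mulrCA ler_piMr ?(ltW e0) //.
by rewrite ler_pdivrMr ?ltr_wpDl // mul1r lerDl.
Qed.

Lemma dRC_scale (c : C) (s : R) : dRC (fun s => (s%:C : C) * c) s c.
Proof.
move=> e e0; apply: (@filterS R (nbhs s) _ setT); last exact: filterT.
move=> y _; rewrite (_ : _ - _ = 0) ?cmod0 ?mulr_ge0 ?(ltW e0) //.
have -> : ((y - s)%:C : C) = y%:C - s%:C by apply: complex_eqP; rewrite /= ?subr0.
by rewrite -mulrBl mulrC subrr.
Qed.

Lemma dRC_line d (F : 'rV[C]_d -> C) (x : 'rV[C]_d) k (phi : R -> C) (t : R) (D : C) :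
  dRC phi t D -> differentiable F (x + phi t *: delta_mx 0 k) ->
  dRC (fun s => F (x + phi s *: delta_mx 0 k)) t
    (D * 'D_(delta_mx 0 k) F (x + phi t *: delta_mx 0 k)).
Proof.
move=> dphi dF.
have hy j : dRC (fun s => (x + phi s *: delta_mx 0 k) 0 j) t (D * (j == k)%:R).
  move=> e e0; move: (dphi e e0); apply: filterS => s hs.
  rewrite line_coord cmodM; apply: le_trans hs.
  by rewrite ler_piMr ?cmod_ge0 //; case: eqP => _; rewrite ?cmod1 ?cmod0.
have := dRC_comp hy (differentiable_expands dF).
rewrite (bigD1 k) //= eqxx mulr1 big1 ?addr0 // => j jk.
by rewrite (negbTE jk) mulr0 mul0r.
Qed.

Lemma complex_eta (z : C) : (Re z +i* Im z : C) = z.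
Proof. by case: z. Qed.

Lemma dRC_continuous (phi : R -> C) (t : R) (D : C) : dRC phi t D -> {for t, continuous phi}.
Proof.
move=> h.
have [dr _] := dRC_Re h; have [di _] := dRC_Im h.
have cr : {for t, continuous (fun s => Re (phi s))}.
  exact: differentiable_continuous (proj1 (derivable1_diffP _ _) dr).
have ci : {for t, continuous (fun s => Im (phi s))}.
  exact: differentiable_continuous (proj1 (derivable1_diffP _ _) di).
have E : (fun s => Re (phi s) +i* Im (phi s) : C) = phi.
  by apply/funext => s; exact: complex_eta.
by have := @cvg_complex R R (nbhs t) (nbhs_filter t) _ _ _ _ cr ci; rewrite complex_eta E.
Qed.

Lemma compact_disc (r : R) : compact [set c : C | cmod c <= r].
Proof.
apply: (subclosed_compact _ (@compact_square R r)).
  have cf : continuous (fun c : C => cmod c).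
    by move=> c; exact: (@cvg_cmod R C (nbhs c) _ _ _ cvg_id).
  exact: (proj1 (continuous_closedP _) cf _ (@closed_le R r)).
by move=> c /= cr; split; apply: (le_trans _ cr); [exact: Re_le_cmod|exact: Im_le_cmod].
Qed.

Lemma line_continuous d (x : 'rV[C]_d) k : continuous (fun c : C => x + c *: delta_mx 0 k).
Proof.
move=> c; apply/(@cvg_rVP R d _ (nbhs c) _) => e e0.
have /(@cvg_cplxP R _ (nbhs c) _) /(_ e e0) : (fun y : C => y) @ nbhs c --> c by exact: cvg_id.
apply: filterS => y; rewrite cmodB => hy.
by rewrite opprD addrACA subrr add0r -scalerBl nrm1_delta.
Qed.

Lemma Rintegral_cst_2pi (c : R) :
  \int[mu]_(t in `[0, 2 * pi]) c = 2 * pi * c.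
Proof.
have pi0 : 0 < 2 * pi :> R by rewrite mulr_gt0 // pi_gt0.
by rewrite Rintegral_cst //= lebesgue_measure_itv /= lte_fin pi0 -EFinB /= subr0 mulrC.
Qed.

(** Circles centred at 0 in the coordinate [k] suffice to integrate out the angles of a torus one at
    a time. The real part suffices as soon as the property holds for all complex multiples of
    [F]. *)
Definition mean_prop d rho (F : 'rV[C]_d -> C) := forall k x r,
  0 <= r < rho -> polydisc rho x -> x 0 k = 0 ->
  \int[mu]_(t in `[0, 2 * pi]) Re (F (x + ((r%:C : C) * cis t) *: delta_mx 0 k)) =
  2 * pi * Re (F x).

Lemma polydisc_line d rho (x : 'rV[C]_d) k (c : C) :
  polydisc rho x -> x 0 k = 0 -> cmod c < rho ->
  polydisc rho (x + c *: delta_mx 0 k).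
Proof.
move=> xr xk cr j; rewrite line_coordE; have [->|jk] := eqVneq j k.
  by rewrite mulr1 xk add0r.
by rewrite mulr0 addr0.
Qed.

(** Along the circles [u = Re F] and [v = Im F]. Complex linearity gives the radial derivative
    [cis t * D] and the angular derivative [i * s * cis t * D], so [s] times the radial derivative
    of [u] is the angular derivative of [v]. *)
Lemma C1_on_mean d rho (F : 'rV[C]_d -> C) :
  C1_on (polydisc rho) F -> mean_prop rho F.
Proof.
move=> [dF cF] k x r /andP[r0 rrho] xr xk.
(* A radius strictly between: the derivative is bounded on the compact disc of radius [r1], and [r]
   is interior to it. *)
pose r1 := (r + rho) / 2.
have rr1 : r < r1 by rewrite /r1 midf_lt.
have r1rho : r1 < rho by rewrite /r1 midf_lt.
pose y (s t : R) := x + ((s%:C : C) * cis t) *: delta_mx 0 k.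
pose D := 'D_(delta_mx 0 k) F.
have yB s t : `|s| < rho -> polydisc rho (y s t).
  by move=> s1; apply: polydisc_line => //; rewrite cmod_real_cis.
have [M MP] : exists M, forall c, cmod c <= r1 -> cmod (D (x + c *: delta_mx 0 k)) <= M.
  have [||c _ cmax] := @compact_EVT_max C R (fun c => cmod (D (x + c *: delta_mx 0 k)))
    [set c : C | cmod c <= r1] _ (@compact_disc r1).
  - by exists 0; rewrite /= cmod0 (le_trans r0) // ltW.
  - apply: continuous_in_subspaceT => c; rewrite inE /= => cr.
    have cB := polydisc_line xr xk (le_lt_trans cr r1rho).
    have h := @continuous_comp _ _ _ _ _ c (@line_continuous d x k c) (cF k _ cB).
    exact: (@cvg_cmod R C (nbhs c) _ _ _ h).
  by exists (cmod (D (x + c *: delta_mx 0 k))) => c' c'r; apply: cmax; rewrite inE.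
have lt1 (s : R) : `|s| < r1 -> `|s| < rho by move=> h; exact: lt_trans r1rho.
have dt (s t : R) : `|s| < r1 -> dRC (fun t => F (y s t)) t
    (((s%:C : C) * (- sin t +i* cos t)) * D (y s t)).
  move=> s1; apply: dRC_line; first exact: dRC_cis.
  by apply: dF; exact: yB s t (lt1 s s1).
have Fx : x + ((0 : R)%:C * cis 0) *: delta_mx 0 k = x.
  by rewrite (_ : (0 : R)%:C * _ = 0 :> C) ?scale0r ?addr0 // mul0r.
have pi0 : 0 < 2 * pi :> R by rewrite mulr_gt0 // pi_gt0.
have E : \int[mu]_(t in `[0, 2 * pi]) Re (F (y r t)) =
    \int[mu]_(t in `[0, 2 * pi]) Re (F (y 0 t)).
  apply: (@polar_mean R (fun s t => Re (F (y s t)))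
    (fun s t => Re (cis t * D (y s t))) (fun s t => Im (F (y s t))) 0 (2 * pi)
    r1 M pi0).
  - move=> s t s1; apply: dRC_Re; apply: (dRC_line (phi := fun s => (s%:C : C) * cis t)).
      exact: dRC_scale.
    by apply: dF; exact: yB s t (lt1 s s1).
  - move=> s t s1.
    have -> : s * Re (cis t * D (y s t)) =
        Im (((s%:C : C) * (- sin t +i* cos t)) * D (y s t)).
      by rewrite !ReCM !ImCM !ReCM /=; ring.
    exact: dRC_Im (dt s t s1).
  - by move=> s s1; rewrite /y /cis cos0 sin0 mulr_natl cos2pi sin2pi.
  - move=> s s1 t; have := dRC_continuous (dt s t s1).
    exact: (@cvg_Re R R (nbhs t) _).
  - move=> s s1 t.
    have cy : {for t, continuous (fun t => (s%:C : C) * cis t)}.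
      exact: dRC_continuous (dRC_cis s t).
    have h1 := @continuous_comp _ _ _ _ _ t cy (@line_continuous d x k _).
    have h2 := @continuous_comp _ _ _ _ _ t h1 (cF k _ (yB s t (lt1 s s1))).
    have cc : {for t, continuous cis}.
      apply: (@cvg_complex R R (nbhs t) _); [exact: continuous_cos|exact: continuous_sin].
    have [_ _ cM] := @funalg_continuous C R t.
    exact: (@cvg_Re R R (nbhs t) _ _ _ (cM _ _ cc h2)).
  - move=> s t s1; apply: le_trans (Re_le_cmod _) _; rewrite cmodM cmod_cis mul1r.
    by apply: MP; rewrite cmod_real_cis ltW.
  by rewrite r0 rr1.
transitivity (\int[mu]_(t in `[0, 2 * pi]) Re (F (y 0 t))); first exact: E.
have -> : (fun t => Re (F (y 0 t))) = (fun=> Re (F x)).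
  by apply/funext => t; rewrite /y mul0r scale0r addr0.
exact: Rintegral_cst_2pi.
Qed.

End CircleMean.

(** * The mean value property on tori *)

Lemma row_mx_line (K : pzRingType) d (a : 'rV[K]_1) (x : 'rV[K]_d) (z : K) k :
  row_mx a (x + z *: delta_mx 0 k) =
  row_mx a x + z *: delta_mx 0 (rshift 1 k).
Proof.
apply/rowP => j; case: (split_ordP j) => i ->.
  rewrite row_mxEl [RHS]mxE row_mxEl !mxE eqxx /= (_ : _ == _ = false).
    by rewrite mulr0 addr0.
  by apply/eqP => /(congr1 val) /= h; case: i h => i /= hi h; move: hi; rewrite h.
rewrite row_mxEr [RHS]mxE row_mxEr !mxE eqxx /=.
by congr (_ + _ * _%:R); congr (nat_of_bool _); apply/eqP/eqP => [->|/rshift_inj].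
Qed.

Lemma row_mx_line0 (K : pzRingType) d (z : K) :
  row_mx (z%:M : 'rV[K]_1) (0 : 'rV[K]_d) = 0 + z *: delta_mx 0 ord0 :> 'rV[K]_d.+1.
Proof.
apply/rowP => j; rewrite add0r !mxE; case: splitP => i ji.
  by rewrite mxE ord1 eqxx (_ : j = ord0) ?eqxx ?mulr1 ?mulr1n //; apply: val_inj; rewrite /= ji ord1.
rewrite mxE (_ : j == ord0 = false) ?andbF ?mulr0 //.
by apply/eqP => j0; move: ji; rewrite j0.
Qed.

Section LimitClass.
Variable R : realType.
Local Notation C := (Cplx R).
Local Notation Re := (@complex.Re R).
Local Notation Im := (@complex.Im R).
Local Notation mu := (@lebesgue_measure R).

Lemma compact_polydisc d (r : R) :
  compact [set x : 'rV[C]_d | forall j, cmod (x 0 j) <= r].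
Proof.
exact: (@rV_compact C d (fun=> [set c : C | cmod c <= r]) (fun=> @compact_disc R r)).
Qed.

(* This class contains the partial derivatives of a holomorphic function, as
   limits of difference quotients; no Cauchy formula is needed. *)
Definition limit_class d (rho : R) (F : 'rV[C]_d -> C) :=
  exists Fn : nat -> 'rV[C]_d -> C,
  [/\ forall n, C1_on (polydisc rho) (Fn n),
      forall x, polydisc rho x -> Fn n x @[n --> \oo] --> F x
    & forall r, r < rho -> exists M : R, forall n (x : 'rV[C]_d),
        (forall j, cmod (x 0 j) <= r) -> cmod (Fn n x) <= M].

Lemma open_polydisc d (rho : R) : open (@polydisc R d rho).
Proof.
rewrite openE => x xr.
have : nbhs x (fun y => forall j, cmod (y 0 j) < rho).
  apply: (filter_forall (F := nbhs x)) => j.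
  have e0 : 0 < rho - cmod (x 0 j) by rewrite subr_gt0.
  apply/nbhs_rVP; exists (rho - cmod (x 0 j)) => // y yx.
  rewrite -[y 0 j](subrK (x 0 j)) (le_lt_trans (cmodD _ _)) // -ltrBrDr.
  by apply: le_lt_trans yx; rewrite (le_trans _ (cmod_le_nrm1 _ j)) // !mxE.
by [].
Qed.

Lemma C1_on_limit_class d (rho : R) (F : 'rV[C]_d -> C) :
  C1_on (polydisc rho) F -> limit_class rho F.
Proof.
move=> hF; exists (fun=> F); split=> // [x _|r rrho]; first exact: cvg_cst.
(* For negative [r] the closed polydisc can be empty, and the extremum theorem asks for a point. *)
have [[x0 x0r]|none] := pselect (exists x : 'rV[C]_d, forall j, cmod (x 0 j) <= r).
  have [||c _ cmax] := @compact_EVT_max _ R (fun x => cmod (F x))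
    [set x : 'rV[C]_d | forall j, cmod (x 0 j) <= r] _ (@compact_polydisc d r).
  - by exists x0.
  - apply: continuous_in_subspaceT => c; rewrite inE /= => cr.
    have cB : polydisc rho c by move=> j; exact: le_lt_trans (cr j) rrho.
    exact: (@cvg_cmod R _ (nbhs c) _ _ _ (C1_on_continuous hF cB)).
  by exists (cmod (F c)) => _ x xr; apply: cmax; rewrite inE.
by exists 0 => _ x xr; case: none; exists x.
Qed.

(** Approximating sequences are added and multiplied termwise. The bounds, uniform in the index on
    each smaller polydisc, add and multiply too. *)
Lemma funalg_limit_class d (rho : R) : funalg (@limit_class d rho).
Proof.
have [Cc CD CM] := @funalg_C1_on C d _ (@open_polydisc d rho).
split=> [c|f g [fn [fC fl fM]] [gn [gC gl gM]]|f g [fn [fC fl fM]] [gn [gC gl gM]]].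
- exact: C1_on_limit_class (Cc c).
- exists (fun n x => fn n x + gn n x); split=> [n|x xr|r rrho].
  + exact: CD.
  + exact: (@cvgD _ C^o _ \oo _ _ _ _ _ (fl x xr) (gl x xr)).
  have [M MP] := fM r rrho; have [N NP] := gM r rrho.
  exists (M + N) => n x xr; apply: le_trans (cmodD _ _) _.
  by rewrite lerD ?MP ?NP.
exists (fun n x => fn n x * gn n x); split=> [n|x xr|r rrho].
+ exact: CM.
+ exact: (@cvgM C _ \oo _ _ _ _ _ (fl x xr) (gl x xr)).
have [M MP] := fM r rrho; have [N NP] := gM r rrho.
exists (M * N) => n x xr; rewrite cmodM.
by rewrite ler_pM ?cmod_ge0 ?MP ?NP.
Qed.

Lemma Rintegral_dominated (a b M : R) (fn : nat -> R -> R) (f : R -> R) :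
  (forall n, continuous (fn n)) ->
  (forall t, fn n t @[n --> \oo] --> f t) ->
  (forall n t, `|fn n t| <= M) ->
  \int[mu]_(t in `[a, b]) fn n t @[n --> \oo] --> \int[mu]_(t in `[a, b]) f t.
Proof.
move=> cfn lim bound.
have int_cont (h : R -> R) : continuous h -> mu.-integrable `[a, b] (EFin \o h).
  move=> ch; apply: continuous_compact_integrable; first exact: segment_compact.
  exact: continuous_subspaceT.
have mfn n := measurable_int mu (int_cont _ (cfn n)).
have limE t : `[a, b]%classic t -> (EFin \o fn n) t @[n --> \oo] --> (EFin \o f) t.
  by move=> _; apply: cvg_EFin; [exact: nearW|exact: lim].
have mf := measurable_realfun.emeasurable_fun_cvg (fun n => EFin \o fn n) (EFin \o f) mfn limE.
have iM : mu.-integrable `[a, b] (EFin \o (fun=> M)).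
  by apply: int_cont => x; exact: cvg_cst.
have [||intf _ cv] := @dominated_convergence _ _ R mu `[a, b] (measurable_itv _)
    (fun n => EFin \o fn n) (EFin \o f) (EFin \o (fun=> M)) mfn mf _ iM.
- by apply: aeW => t; exact: limE.
- by apply: aeW => t n _ /=; rewrite lee_fin.
have ffin : (\int[mu]_(t in `[a, b]) (EFin \o f) t)%E \is a fin_num.
  by apply: integrable_fin_num.
by move: cv; rewrite -(fineK ffin) => /fine_cvg.
Qed.

(* The factor [a] makes the property stable under scaling, so that it yields
   both the real and the imaginary part. *)
Lemma limit_class_mean d rho (F : 'rV[C]_d -> C) : limit_class rho F ->
  forall a, mean_prop rho (fun x => a * F x).
Proof.
move=> hF a.
have [Cc _ CM] := @funalg_limit_class d rho.
have [fn [fC fl fM]] := CM _ _ (Cc a) hF => {hF Cc CM}.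
move=> k x r /andP[r0 rrho] xr xk.
pose y t := x + ((r%:C : C) * cis t) *: delta_mx 0 k.
have yB t : polydisc rho (y t).
  by apply: polydisc_line => //; rewrite cmod_real_cis ger0_norm.
(* One radius [r'] below [rho] dominates both the circle and the fixed coordinates of [x], so a
   single bound [M] serves the whole circle. *)
have [r' [r'rho rr' xr']] : exists r', [/\ r' < rho, r <= r' &
    forall j, cmod (x 0 j) <= r'].
  exists (\big[Num.max/r]_j cmod (x 0 j)); split.
  - by elim/big_ind : _ => // u v ur vr; rewrite gt_max ur vr.
  - by rewrite bigmax_idl le_max lexx.
  by move=> j; exact: le_bigmax.
have [M MP] := fM r' r'rho.
have yM n t : cmod (fn n (y t)) <= M.
  apply: MP => j; rewrite line_coordE; have [->|jk] := eqVneq j k.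
    by rewrite mulr1 xk add0r cmod_real_cis ger0_norm.
  by rewrite mulr0 addr0.
have cy : continuous y.
  move=> t; have cc := dRC_continuous (dRC_cis r t).
  exact: (@continuous_comp _ _ _ _ _ t cc (@line_continuous R d x k _)).
have L1 : \int[mu]_(t in `[0, 2 * pi]) Re (fn n (y t)) @[n --> \oo] -->
    \int[mu]_(t in `[0, 2 * pi]) Re (a * F (y t)).
  apply: (@Rintegral_dominated 0 (2 * pi) M) => [n t|t|n t].
  - have h := @continuous_comp _ _ _ _ _ t (cy t) (C1_on_continuous (fC n) (yB t)).
    exact: (@cvg_Re R R (nbhs t) _ _ _ h).
  - exact: (@cvg_Re R _ \oo _ _ _ (fl _ (yB t))).
  exact: le_trans (Re_le_cmod _) (yM n t).
have L2 : \int[mu]_(t in `[0, 2 * pi]) Re (fn n (y t)) @[n --> \oo] -->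
    2 * pi * Re (a * F x).
  rewrite (_ : (fun n => _) = fun n => 2 * pi * Re (fn n x)); last first.
    apply/funext => n.
    by apply: (C1_on_mean (fC n)) => //; rewrite r0 rrho.
  apply: cvgMl_tmp; exact: (@cvg_Re R _ \oo _ _ _ (fl _ xr)).
exact: (cvg_unique _ L1 L2).
Qed.

Definition torus d (r : R) (t : 'rV[R]_d) : 'rV[C]_d :=
  \row_j ((r%:C : C) * cis (t 0 j)).

Lemma torus_row_mx d (r s : R) (u : 'rV[R]_d) :
  torus r (row_mx (s%:M : 'rV[R]_1) u) =
  row_mx (((r%:C : C) * cis s)%:M : 'rV[C]_1) (torus r u).
Proof.
apply/rowP => j; rewrite mxE; case: (split_ordP j) => i ->.
  by rewrite !row_mxEl !mxE !ord1.
by rewrite !row_mxEr mxE.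
Qed.

Lemma mean_prop_row_mx d rho (F : 'rV[C]_(1 + d) -> C) (c : C) : cmod c < rho ->
  mean_prop rho F ->
  mean_prop rho (fun x : 'rV[C]_d => F (row_mx (c%:M : 'rV[C]_1) x)).
Proof.
move=> cr H k x r rr xr xk.
have yr : polydisc rho (row_mx (c%:M : 'rV[C]_1) x).
  move=> j; case: (split_ordP j) => i ->; first by rewrite row_mxEl ord1 mxE.
  by rewrite row_mxEr.
have yk : row_mx (c%:M : 'rV[C]_1) x 0 (rshift 1 k) = 0 by rewrite row_mxEr.
rewrite -(H (rshift 1 k) _ r rr yr yk); apply: eq_Rintegral => t _.
congr (Re (F _)); exact: row_mx_line.
Qed.

(** Induction on [d]: with the first angle frozen, the other variables average to 0, which leaves a
    circle in the first coordinate through which the mean property is used once more. The general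
    factor [a] absorbs the powers of [2 * pi] produced on the way. *)
Lemma cube_mean d (a : C) (rho r : R) (F : 'rV[C]_d -> C) :
  (forall a, mean_prop rho (fun x => a * F x)) -> 0 <= r < rho ->
  cube_Rintegral (fun t => Re (a * F (torus r t))) = (2 * pi) ^+ d * Re (a * F 0).
Proof.
elim: d a F => [|d IH] a F H /andP[r0 rrho].
  by rewrite /= mul1r; congr (Re (_ * F _)); apply/rowP => -[].
have torus_row s (u : 'rV[R]_d) :
    torus r (row_mx (s%:M : 'rV[R]_1) u : 'rV[R]_d.+1) =
    row_mx (((r%:C : C) * cis s)%:M : 'rV[C]_1) (torus r u) :> 'rV[C]_d.+1.
  exact: torus_row_mx.
rewrite /=.
have E s : cube_Rintegral (fun u : 'rV[R]_d =>
     Re (a * F (torus r (row_mx (s%:M : 'rV[R]_1) u)))) =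
   Re ((((2 * pi) ^+ d)%:C * a) * F (0 + ((r%:C : C) * cis s) *: delta_mx 0 ord0)).
  rewrite (_ : (fun u => _) = (fun u => Re (a * F (row_mx
      (((r%:C : C) * cis s)%:M : 'rV[C]_1) (torus r u))))); last first.
    by apply/funext => u; rewrite torus_row.
  rewrite (IH a (fun x => F (row_mx (((r%:C : C) * cis s)%:M : 'rV[C]_1) x))).
  - rewrite -mulrA (ReCM (_%:C)) /= mul0r subr0; congr (_ * Re (_ * F _)).
    exact: row_mx_line0.
  - move=> b; apply: (mean_prop_row_mx (F := fun x => b * F x)); last exact: H.
    by rewrite cmod_real_cis ger0_norm.
  by rewrite r0 rrho.
under eq_Rintegral do rewrite E.
rewrite (H _ ord0 0 r _ _ _) ?r0 ?rrho ?mxE //; last first.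
  by move=> j; rewrite mxE cmod0 (le_lt_trans r0).
by rewrite -(mulrA _ a) (ReCM (_%:C)) /= mul0r subr0 exprS mulrA.
Qed.

End LimitClass.

(** * Kronecker products and adjugates *)

Lemma kron_mul (K : comPzRingType) d : forall (m n p : 'I_d -> nat)
    (A : forall i, 'M[K]_(m i, n i)) (B : forall i, 'M[K]_(n i, p i)),
  kron A *m kron B = kron (fun i => A i *m B i).
Proof.
elim: d => [|d IH] m n p A B; first by rewrite /= mul1mx.
by rewrite /= tensmx_mul IH.
Qed.

Lemma tensmxZ (K : comPzRingType) m n p q (a b : K) (A : 'M[K]_(m, n)) (B : 'M[K]_(p, q)) :
  (a *: A) *t (b *: B) = (a * b) *: (A *t B).
Proof. by apply/matrixP => i j; rewrite !mxE mulrACA. Qed.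

Lemma tens1mx1 (K : pzRingType) m n : (1%:M : 'M[K]_m) *t (1%:M : 'M[K]_n) = 1%:M.
Proof.
apply/matrixP => a b.
rewrite -[a]mxtens_unindexK -[b]mxtens_unindexK.
move: (mxtens_unindex a) (mxtens_unindex b) => [i1 i2] [j1 j2].
rewrite tensmxE !mxE (inj_eq (can_inj (@mxtens_indexK m n))) xpair_eqE.
by case: (i1 == j1); case: (i2 == j2); rewrite ?(mulr1, mul1r, mulr0, mul0r).
Qed.

Lemma kron_scale (K : comPzRingType) d : forall (m n : 'I_d -> nat)
    (c : 'I_d -> K) (A : forall i, 'M[K]_(m i, n i)),
  kron (fun i => c i *: A i) = (\prod_i c i) *: kron A.
Proof.
elim: d => [|d IH] m n c A; first by rewrite big_ord0 scale1r.
by rewrite big_ord_recl /= IH tensmxZ.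
Qed.

Lemma kron_scalar1 (K : pzRingType) d : forall n : 'I_d -> nat,
  kron (fun i => 1%:M : 'M[K]_(n i)) = 1%:M.
Proof. by elim: d => [|d IH] n //=; rewrite IH tens1mx1. Qed.

Lemma kron_conjT (K : numClosedFieldType) d : forall (m n : 'I_d -> nat)
    (A : forall i, 'M[K]_(m i, n i)),
  (kron A) ^t* = kron (fun i => (A i) ^t*).
Proof.
elim: d => [|d IH] m n A; first by rewrite /= trmx1 map_mx1.
by rewrite /= trmx_tens map_mxT IH.
Qed.

(** Adjugates stay regular at the eigenvalue, so the whole singularity of the inverse is confined to
    the scalar factor. *)
Lemma invmx_kron (K : fieldType) d (n : 'I_d -> nat) (A : forall i, 'M[K]_(n i)) :
  (forall i, \det (A i) != 0) ->
  invmx (kron A) = (\prod_i (\det (A i))^-1) *: kron (fun i => \adj (A i)).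
Proof.
move=> A0.
have AB : kron A *m ((\prod_i (\det (A i))^-1) *: kron (fun i => \adj (A i))) = 1%:M.
  rewrite -kron_scale kron_mul -(kron_scalar1 K n); congr (kron _).
  apply/functional_extensionality_dep => i.
  by rewrite -scalemxAr mul_mx_adj scale_scalar_mx mulVf.
have [uA _] := mulmx1_unit AB.
by rewrite -[LHS]mulmx1 -AB mulKmx.
Qed.

(** A nonzero cofactor is, up to sign, the determinant of an invertible submatrix of size [n - 1],
    and passing to a submatrix cannot raise the rank. *)
Lemma adj_neq0_rank (K : fieldType) n (A : 'M[K]_n) :
  \adj A != 0 -> (n.-1 <= \rank A)%N.
Proof.
case: n A => [|n] A adjA //=.
have [i [j Aij]] : exists i j, cofactor A i j != 0.
  apply: contrapT => H; case/eqP: adjA; apply/matrixP => i j; rewrite !mxE.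
  by apply/eqP; apply: contra_notT H => h; exists j, i.
have uM : row' i (col' j A) \in unitmx.
  rewrite unitmxE unitfE; apply: contra Aij => /eqP d0.
  by rewrite /cofactor d0 mulr0.
have rk : \rank (row' i (col' j A)) = n := mxrank_unit uM.
rewrite -{1}rk row'Esub col'Esub rowsubE.
apply: leq_trans (mxrankM_maxr _ _) _.
by rewrite -[A in colsub _ A]mulmx1 -mulmx_colsub; exact: mxrankM_maxl.
Qed.

(** [A] is singular, so the rows of its adjugate lie in the left kernel. If the adjugate is nonzero,
    the rank bound makes that kernel the line spanned by [w]. *)
Lemma adj_left_kernel (K : fieldType) n (A : 'M[K]_n) (w : 'rV[K]_n) :
  w != 0 -> w *m A = 0 -> exists u : 'cV[K]_n, \adj A = u *m w.
Proof.
move=> w0 wA.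
have [->|adjA] := eqVneq (\adj A) 0; first by exists 0; rewrite mul0mx.
have dA : \det A = 0.
  apply/eqP; apply: contraNT w0 => dA.
  by rewrite -[w](mulmxK (_ : A \in unitmx)) ?unitmxE ?unitfE // wA mul0mx.
have adjker : (\adj A <= kermx A)%MS.
  by apply/sub_kermxP; rewrite mul_adj_mx dA raddf0.
have wker : (w <= kermx A)%MS by apply/sub_kermxP.
have rk : (\rank (kermx A) <= \rank w)%N.
  rewrite mxrank_ker rank_rV w0 leq_subLR addn1.
  by apply: leq_trans (leqSpred n) _; rewrite ltnS adj_neq0_rank.
have kerw : (kermx A <= w)%MS by rewrite -(mxrank_leqif_sup wker) eqn_leq rk mxrankS.
by have /submxP[u ->] := submx_trans adjker kerw; exists u.
Qed.

(* [E] stands for the derivative of [\adj A] along a direction in which [\det A]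
   has derivative 1, so that the last hypothesis is the product rule for
   [\adj A *m A = (\det A)%:M]. *)
Lemma adj_eigenvectors (K : fieldType) n (A D E : 'M[K]_n) (v : 'cV[K]_n) (w : 'rV[K]_n) :
  w != 0 -> A *m v = 0 -> w *m A = 0 -> w *m D *m v = 1%:M ->
  E *m A + \adj A *m D = 1%:M -> \adj A = v *m w.
Proof.
move=> w0 Av wA wDv H; have [u adjE] := adj_left_kernel w0 wA.
rewrite adjE; congr (_ *m w).
(* Applied to [v], the term with [E] vanishes and the scaling turns the other one into [u]; hence
   [u = v]. *)
have : (E *m A + \adj A *m D) *m v = v by rewrite H mul1mx.
by rewrite mulmxDl -mulmxA Av mulmx0 add0r adjE -!mulmxA (mulmxA w) wDv mulmx1.
Qed.

Lemma derive_mulmx (K : numFieldType) (V : normedModType K) m n p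
    (A : V -> 'M[K]_(m, n)) (B : V -> 'M[K]_(n, p)) (x v : V) :
  (forall i j, derivable (fun y => A y i j) x v) ->
  (forall i j, derivable (fun y => B y i j) x v) ->
  forall i j, 'D_v (fun y => (A y *m B y) i j) x =
    ((\matrix_(i, k) 'D_v (fun y => A y i k) x) *m B x +
     A x *m (\matrix_(k, j) 'D_v (fun y => B y k j) x)) i j.
Proof.
move=> dA dB i j.
have E : (fun y => (A y *m B y) i j) =
    \sum_k ((fun y => A y i k) * (fun y => B y k j)).
  by apply/funext => y; rewrite mxE fct_sumE.
rewrite E derive_sum => [|k]; last exact: derivableM.
rewrite !mxE -big_split /=; apply: eq_bigr => k _.
rewrite !mxE deriveM // addrC; congr (_ + _).
by rewrite mulrC.
Qed.

(** * The parametrized torus *)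

Section Torus.
Variable R : realType.
Local Notation C := (Cplx R).
Local Notation Re := (@complex.Re R).
Local Notation Im := (@complex.Im R).

Lemma cos_eq1 (u : R) : 0 <= u < 2 * pi -> cos u = 1 -> u = 0.
Proof.
move=> /andP[u0 u2] cu; have pi0 := pi_gt0 R.
have E2 : pi *+ 2 = 2 * pi :> R by rewrite mulr_natl.
have [upi|upi] := lerP u pi.
  by apply: (@cos_inj R); rewrite ?in_itv /= ?u0 ?lexx ?(ltW pi0) // cu cos0.
have cu' : cos (pi *+ 2 - u) = 1.
  by rewrite -[RHS]cu -[in RHS](cosN u) -(cosD2pi (- u)) addrC.
have : pi *+ 2 - u = 0.
  apply: (@cos_inj R); rewrite ?in_itv /= ?lexx ?(ltW pi0) ?cos0 //.
  by apply/andP; split; lra.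
by rewrite E2 => H; exfalso; lra.
Qed.

Lemma cis_inj (t s : R) : 0 <= t < 2 * pi -> 0 <= s < 2 * pi -> cis t = cis s -> t = s.
Proof.
move=> /andP[t0 t2] /andP[s0 s2] E.
have Ec : cos t = cos s by have := congr1 Re E.
have Es : sin t = sin s by have := congr1 Im E.
have c1 : cos (t - s) = 1 by rewrite cosB Ec Es -!expr2 cos2Dsin2.
have c2 : cos (s - t) = 1 by rewrite -cosN opprB.
apply/eqP; rewrite -subr_eq0; have [st|ts] := lerP s t.
  apply/eqP/cos_eq1 => //; rewrite subr_ge0 st /=.
  by rewrite (le_lt_trans _ t2) // gerBl.
rewrite -oppr_eq0 opprB; apply/eqP/cos_eq1 => //; rewrite subr_ge0 ltW //=.
by rewrite (le_lt_trans _ s2) // gerBl.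
Qed.

Lemma cis_surj (x : C) : cmod x = 1 -> exists2 t : R, 0 <= t < 2 * pi & cis t = x.
Proof.
have pi0 := pi_gt0 R.
have E2 : pi *+ 2 = 2 * pi :> R by rewrite mulr_natl.
move=> x1; have sq : Re x ^+ 2 + Im x ^+ 2 = 1.
  have := congr1 (fun r => r ^+ 2) x1; rewrite cmodE sqr_sqrtr ?expr1n //.
  by rewrite addr_ge0 // sqr_ge0.
have aI : -1 <= Re x <= 1 by rewrite -ler_norml -x1 Re_le_cmod.
have [/andP[t0 tpi] ct] := acos_def aI.
have st : sin (acos (Re x)) = `|Im x|.
  by rewrite sin_acos // -sqrtr_sqr -sq addrAC subrr add0r.
have [b0|b0] := lerP 0 (Im x).
  exists (acos (Re x)).
    by rewrite t0 (le_lt_trans tpi) // mulr_natl mulr2n ltrDl.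
  by apply: complex_eqP; rewrite /= ?ct ?st ?ger0_norm.
(* The lower half circle is reached by reflecting the angle of the upper one; a zero angle would
   reflect to the excluded endpoint [2 * pi]. *)
have tn0 : 0 < acos (Re x).
  rewrite lt_def t0 andbT; apply: contraTneq b0 => t00.
  move: st; rewrite t00 sin0 => /esym/eqP; rewrite normr_eq0 => /eqP ->.
  by rewrite ltxx.
exists (pi *+ 2 - acos (Re x)).
  by rewrite E2; apply/andP; split; lra.
apply: complex_eqP => /=.
  by rewrite addrC cosD2pi cosN ct.
rewrite addrC sinD sinN cosN cos2pi sin2pi mulr1 mulr0 addr0 st.
by rewrite ltr0_norm // opprK.
Qed.

Lemma torus_approx d (r : R) (t0 : 'rV[R]_d) (j : 'I_d) (e : R) : 0 < e ->
  \forall t \near t0, cmod ((torus r t) 0 j - (torus r t0) 0 j -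
    ((t 0 j - t0 0 j)%:C : C) * ((r%:C : C) * (- sin (t0 0 j) +i* cos (t0 0 j)))) <=
    e * \sum_k `|t 0 k - t0 0 k|.
Proof.
move=> e0; have h := dRC_cis r (t0 0 j) e0.
have cj : (fun t : 'rV[R]_d => t 0 j) @ nbhs t0 --> t0 0 j.
  exact: (@coord_continuous R 1 d 0 j t0).
have h' : nbhs t0 (fun t : 'rV[R]_d => cmod ((r%:C : C) * cis (t 0 j) -
    (r%:C : C) * cis (t0 0 j) - ((r%:C : C) * (- sin (t0 0 j) +i* cos (t0 0 j))) *
    (t 0 j - t0 0 j)%:C) <= e * `|t 0 j - t0 0 j|) := cj _ h.
apply: filterS h' => t ht.
rewrite !mxE (mulrC ((t 0 j - t0 0 j)%:C : C)); apply: le_trans ht _.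
rewrite ler_wpM2l ?(ltW e0) // (bigD1 j) //= lerDl sumr_ge0 //.
Qed.

Lemma torus_coord_continuous d (r : R) (j : 'I_d) :
  continuous (fun t : 'rV[R]_d => (torus r t) 0 j).
Proof.
move=> t; have cj : {for t, continuous (fun t : 'rV[R]_d => t 0 j)}.
  exact: (@coord_continuous R 1 d 0 j t).
have h := @continuous_comp _ _ _ _ _ t cj (dRC_continuous (dRC_cis r (t 0 j))).
by rewrite (_ : (fun t => _) = (fun t => ((r%:C : C) * cis t)) \o (fun t : 'rV[R]_d => t 0 j)) //;
  apply/funext => s; rewrite mxE.
Qed.

Lemma sum_dist_cvg0 d (t0 : 'rV[R]_d) :
  (fun t : 'rV[R]_d => \sum_k `|t 0 k - t0 0 k|) @ nbhs t0 --> (0 : R).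
Proof.
have ck k : {for t0, continuous (fun t : 'rV[R]_d => `|t 0 k - t0 0 k|)}.
  have [cc cD _] := @funalg_continuous R 'rV[R]_d t0.
  have h := cD _ _ (@coord_continuous R 1 d 0 k t0) (cc (- t0 0 k)).
  exact: (@continuous_comp _ _ _ (fun t : 'rV[R]_d => t 0 k - t0 0 k)
    (fun x : R => `|x|) t0 h (@norm_continuous R R^o _)).
have := @funalg_sum _ _ _ (@funalg_continuous R 'rV[R]_d t0) _ (index_enum 'I_d)
  xpredT (fun k t => `|t 0 k - t0 0 k|) (fun k _ => ck k).
rewrite /prop_for /continuous_at (_ : \sum_k `|t0 0 k - t0 0 k| = 0) //.
by rewrite big1 // => k _; rewrite subrr normr0.
Qed.

Lemma Re_scale (s : R) (a b c : C) :
  s * Re (a * (b * c)) = Re (a * ((s%:C : C) * b * c)).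
Proof. by rewrite -mulrA [in RHS]mulrCA (ReCM (s%:C : C)) /= mul0r subr0. Qed.

(** Real differentiability of both coordinates of the sheet at once: [a = 1] gives the real part and
    [a = -i] the imaginary part. *)
Lemma torus_C1 d (r : R) (B : set 'rV[C]_d) (F : 'rV[C]_d -> C) (a : C) :
  0 <= r -> C1_on B F -> (forall t, B (torus r t)) ->
  C1_on setT (fun t : 'rV[R]_d => Re (a * F (torus r t))) /\
  forall t k, 'D_(delta_mx 0 k) (fun t : 'rV[R]_d => Re (a * F (torus r t))) t =
    Re (a * (((r%:C : C) * (- sin (t 0 k) +i* cos (t 0 k))) *
      'D_(delta_mx 0 k) F (torus r t))).
Proof.
move=> r0 FB tB.
pose b (t : 'rV[R]_d) k : C := (r%:C : C) * (- sin (t 0 k) +i* cos (t 0 k)).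
have cb t k : cmod (b t k) = r.
  by rewrite cmodM cmodC ger0_norm // cmodE /= sqrrN sin2cos2 subrK sqrtr1 mulr1.
have E t : expands (fun t : 'rV[R]_d => Re (a * F (torus r t))) t
    (fun k => Re (a * (b t k * 'D_(delta_mx 0 k) F (torus r t)))).
  move=> e e0.
  have fa := differentiable_expands (FB.1 _ (tB t)).
  have H := @expands_comp R d _ (nbhs t) _ (fun s => \sum_k `|s 0 k - t 0 k|)
    (torus r) (torus r t) (fun j s => ((s 0 j - t 0 j)%:C : C) * b t j) r F _ r0
    _ (@sum_dist_cvg0 d t) _ _ fa.
  have a0 : 0 < cmod a + 1 by rewrite ltr_wpDl // cmod_ge0.
  have e1 : 0 < e / (cmod a + 1) by rewrite divr_gt0.
  have : \forall s \near t, cmod (F (torus r s) - F (torus r t) -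
      \sum_j (((s 0 j - t 0 j)%:C : C) * b t j) * 'D_(delta_mx 0 j) F (torus r t)) <=
      e / (cmod a + 1) * \sum_k `|s 0 k - t 0 k|.
    apply: H => //.
    - by move=> s; exact: sumr_ge0.
    - move=> j s; rewrite cmodM cmodC cb mulrC ler_wpM2l //.
      by rewrite (bigD1 j) //= lerDl sumr_ge0.
    - by move=> j e' e'0; exact: torus_approx.
  apply: filterS => s hs.
  have -> : \sum_j (s 0 j - t 0 j) * Re (a * (b t j * 'D_(delta_mx 0 j) F (torus r t))) =
     Re (a * \sum_j (((s 0 j - t 0 j)%:C : C) * b t j) * 'D_(delta_mx 0 j) F (torus r t)).
    rewrite mulr_sumr Re_sum; apply: eq_bigr => j _.
    exact: Re_scale.
  rewrite -!ReCN -!ReCD -!mulrBr; apply: le_trans (Re_le_cmod _) _.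
  rewrite cmodM; apply: le_trans (ler_wpM2l (cmod_ge0 a) hs) _.
  rewrite mulrA ler_wpM2r ?sumr_ge0 // mulrCA ler_piMr ?(ltW e0) //.
  by rewrite ler_pdivrMr // mul1r lerDl.
split=> [|t k]; last by have [_] := expands_differentiable (E t); exact.
split=> [t _|k t _]; first by have [] := expands_differentiable (E t).
have -> : 'D_(delta_mx 0 k) (fun t : 'rV[R]_d => Re (a * F (torus r t))) =
   (fun t => Re (a * (b t k * 'D_(delta_mx 0 k) F (torus r t)))).
  by apply/funext => s; have [_] := expands_differentiable (E s); exact.
have [cc _ cM] := @funalg_continuous C 'rV[R]_d t.
have ct : {for t, continuous (torus r)}.
  by apply: continuous_rV => j; exact: torus_coord_continuous.
have cD := @continuous_comp _ _ _ _ _ t ct (FB.2 k _ (tB t)).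
have cj : {for t, continuous (fun t : 'rV[R]_d => t 0 k)}.
  exact: (@coord_continuous R 1 d 0 k t).
have cs : {for t, continuous (fun t : 'rV[R]_d => - sin (t 0 k))}.
  apply: (@continuousN R R^o _ _ t).
  exact: (@continuous_comp _ _ _ _ _ t cj (@continuous_sin R _)).
have cco : {for t, continuous (fun t : 'rV[R]_d => cos (t 0 k))}.
  exact: (@continuous_comp _ _ _ _ _ t cj (@continuous_cos R _)).
have cb' := @cvg_complex R _ (nbhs t) (nbhs_filter t) _ _ _ _ cs cco.
have h := cM _ _ (cc a) (cM _ _ (cM _ _ (cc (r%:C : C)) cb') cD).
exact: (@cvg_Re R _ (nbhs t) (nbhs_filter t) _ _ h).
Qed.

End Torus.

(** * Partial derivatives as limits of difference quotients *)

Lemma expands_coord (K : numFieldType) d (z : 'rV[K]_d) (j : 'I_d) :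
  expands (fun x => x 0 j) z (fun k => (k == j)%:R).
Proof.
move=> e e0; apply: (@filterS _ (nbhs z) _ setT); last exact: filterT.
move=> x _; rewrite (bigD1 j) //= eqxx mulr1 big1 => [|k kj].
  by rewrite addr0 subrr normr0 mulr_ge0 ?(ltW e0) // sumr_ge0.
by rewrite (negbTE kj) mulr0.
Qed.

Lemma derive_coord (K : numFieldType) d (z : 'rV[K]_d) (j k : 'I_d) :
  'D_(delta_mx 0 k) (fun x : 'rV[K]_d => x 0 j) z = (k == j)%:R.
Proof. by have [_] := expands_differentiable (expands_coord z j); exact. Qed.

Lemma C1_on_coord (K : numFieldType) d (W : set 'rV[K]_d) (j : 'I_d) :
  C1_on W (fun x => x 0 j).
Proof.
split=> [z _|k z _]; first by have [] := expands_differentiable (expands_coord z j).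
rewrite (_ : 'D_(delta_mx 0 k) (fun x : 'rV[K]_d => x 0 j) = fun=> (k == j)%:R); last first.
  by apply/funext => x; exact: derive_coord.
by have [cc _ _] := @funalg_continuous K 'rV[K]_d z; exact: cc.
Qed.

Lemma difference_quotient (K : fieldType) (h a b D : K) : h != 0 ->
  D - h^-1 * (a + -1 * b) = - (h^-1 * (a - b - h * D)).
Proof. by move=> h0; field. Qed.

Section DerivativeLimit.
Variable R : realType.
Local Notation C := (Cplx R).

(** The approximants are difference quotients in the direction [k]: each is C^1, and the Lipschitz
    constant [L] bounds them all. Their steps, harmonic multiples of [rho / 2], stay below [rho], so
    that the shifted points remain in [B]. *)
Lemma derive_limit_class d (rho L : R) (B : set 'rV[C]_d) (F : 'rV[C]_d -> C) k :
  0 < rho -> open B -> C1_on B F ->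
  (forall x x', B x -> B x' -> cmod (F x - F x') <= L * nrm1 (x - x')) ->
  (forall x (c : C), polydisc rho x -> cmod c < rho -> B (x + c *: delta_mx 0 k)) ->
  limit_class rho ('D_(delta_mx 0 k) F).
Proof.
move=> rho0 oB FB lipF lineB.
pose del n : R := rho / 2 * harmonic n.
have del0 n : 0 < del n by rewrite mulr_gt0 ?divr_gt0 // invr_gt0.
have delrho n : del n < rho.
  apply: (@le_lt_trans _ _ (rho / 2)); last by rewrite ltr_pdivrMr // ltr_pMr // ltr1n.
  rewrite ler_piMr ?divr_ge0 ?(ltW rho0) //.
  by rewrite /harmonic /= invf_le1 ?ltr0n // ler1n.
have delC n : ((del n)%:C : C) != 0 by rewrite -cmod_gt0 cmodC gtr0_norm.
have PB x : polydisc rho x -> B x.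
  move=> xr; rewrite -[x]addr0 -(scale0r (delta_mx 0 k)).
  by apply: lineB => //; rewrite cmod0.
have oP := @open_polydisc R d rho.
have [Cc CD CM] := @funalg_C1_on C d _ oP.
exists (fun n x => ((del n)%:C : C)^-1 *
  (F (x + ((del n)%:C : C) *: delta_mx 0 k) + -1 * F x)); split.
- move=> n; apply: (CM); first exact: Cc.
  apply: (CD); last by apply: (CM); [exact: Cc|exact: C1_on_subset FB].
  apply: (C1_on_comp oP _ _ FB).1 => [j|x xr]; last first.
    by apply: lineB => //; rewrite cmodC gtr0_norm.
  have -> : (fun y : 'rV[C]_d => (y + ((del n)%:C : C) *: delta_mx 0 k) 0 j) =
      (fun y : 'rV[C]_d => y 0 j + (((del n)%:C : C) * (j == k)%:R)).
    by apply/funext => y; rewrite line_coordE.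
  by apply: (CD); [exact: C1_on_coord|exact: Cc].
- move=> x xr.
  have dx : is_derive x (delta_mx 0 k) F ('D_(delta_mx 0 k) F x).
    by apply: derivableP; apply: diff_derivable; apply: FB.1; exact: PB.
  apply/(@cvg_cplxP R _ \oo _) => e e0.
  have e2 : (0 : C) < (e / 2)%:C by rewrite ltrC divr_gt0.
  have near0 := proj1 (is_deriveP _ _ _ _) dx _ e2.
  have cdel : (fun n => ((del n)%:C : C)) @ \oo --> (0 : C).
    apply/(@cvg_cplxP R _ \oo _) => e' e'0.
    have cd : del n @[n --> \oo] --> (0 : R).
      by rewrite -[X in _ --> X](mulr0 (rho / 2)); apply: cvgMl_tmp; exact: cvg_harmonic.
    move/cvgrPdist_lt : cd => /(_ _ e'0); apply: filterS => n.
    by rewrite !sub0r cmodN cmodC normrN.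
  have ev : \forall n \near \oo, `|F (((del n)%:C : C) *: delta_mx 0 k + x) - F x -
      ((del n)%:C : C) *: 'D_(delta_mx 0 k) F x| <= ((e / 2)%:C : C) * `|((del n)%:C : C)|.
    exact: cdel _ near0.
  apply: filterS ev => n; rewrite !normcE => hn.
  have {}hn : cmod (F (((del n)%:C : C) *: delta_mx 0 k + x) - F x -
      ((del n)%:C : C) * 'D_(delta_mx 0 k) F x) <= e / 2 * del n.
    move: hn; rewrite cmodC gtr0_norm //.
    have -> : ((e / 2)%:C : C) * (del n)%:C = (e / 2 * del n)%:C.
      by apply: complex_eqP; rewrite ?ReCM ?ImCM /= ?(mul0r, mulr0, subr0, addr0).
    by rewrite lerC.
  rewrite (addrC _ x) in hn.
  rewrite difference_quotient // cmodN cmodM cmodV cmodC gtr0_norm //.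
  apply: (@le_lt_trans _ _ ((del n)^-1 * (e / 2 * del n))).
    by apply: ler_wpM2l hn; rewrite invr_ge0 ltW.
  by rewrite mulrC mulfK ?gt_eqF // ltr_pdivrMr // ltr_pMr // ltr1n.
move=> r rrho; exists L => n x xr.
have xB : polydisc rho x by move=> j; exact: le_lt_trans (xr j) rrho.
rewrite cmodM cmodV cmodC gtr0_norm // ler_pdivrMl // mulN1r mulrC.
apply: le_trans (lipF _ _ _ (PB _ xB)) _.
  by apply: lineB => //; rewrite cmodC gtr0_norm.
by rewrite addrAC subrr add0r nrm1_delta cmodC gtr0_norm.
Qed.

End DerivativeLimit.

(** * The local coordinates at a simple eigenvalue *)

Lemma derive_adj_mulmx (K : numFieldType) (V : normedModType K) m (A : V -> 'M[K]_m)
    (D : 'M[K]_m) (x v : V) :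
  (forall i j, derivable (fun y => A y i j) x v) ->
  (forall i j, derivable (fun y => (\adj (A y)) i j) x v) ->
  'D_v (fun y => \det (A y)) x = 1 ->
  (forall i j, D i j = 'D_v (fun y => A y i j) x) ->
  exists E : 'M[K]_m, E *m A x + \adj (A x) *m D = 1%:M.
Proof.
move=> dA dB d1 DE; exists (\matrix_(i, j) 'D_v (fun y => (\adj (A y)) i j) x).
have -> : D = \matrix_(i, j) 'D_v (fun y => A y i j) x.
  by apply/matrixP => i j; rewrite mxE.
apply/matrixP => i j; rewrite -(derive_mulmx dB dA).
rewrite (_ : (fun y => _) = (fun y => \det (A y) *+ (i == j))); last first.
  by apply/funext => y; rewrite mul_adj_mx mxE.
rewrite [RHS]mxE; case: eqP => _ //.
by rewrite mulr0n; exact: derive_cst.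
Qed.

Section SimpleEigenvalue.
Variables (R : realType) (d : nat) (n : 'I_d -> nat).
Local Notation C := (Cplx R).
Variables (W U : set 'rV[C]_d) (P : forall i : 'I_d, 'rV[C]_d -> 'M[C]_(n i)).
Variable z0 : 'rV[C]_d.
Hypothesis oW : open W.
Hypothesis PW : forall i (a b : 'I_(n i)), C1_on W (fun z => P i z a b).
Hypothesis Wz0 : W z0.
Hypothesis simple_z0 : is_simple_eigenvalue P z0.

Local Notation p := (det_system P).

Lemma det_systemE z i : p z 0 i = \det (P i z).
Proof. by rewrite /det_system mxE. Qed.

Lemma det_system_coord i : (fun z => p z 0 i) = (fun z => \det (P i z)).
Proof. by apply/funext => z; exact: det_systemE. Qed.

Lemma det_system_C1 i : C1_on W (fun z => p z 0 i).
Proof.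
rewrite det_system_coord.
exact: (@funalg_det _ _ _ (funalg_C1_on oW) _ (P i) (PW (i := i))).
Qed.

Lemma jacobian_det_system z : jacobian_mx p z = jac_det_system P z.
Proof.
apply/matrixP => i j.
have E := congr1 (fun f => 'D_(delta_mx 0 j) f z) (det_system_coord i).
have E1 := mxE matrix_key (fun i j => 'D_(delta_mx 0 j) (fun y => p y 0 i) z) i j.
have E2 := mxE matrix_key (fun i j => 'D_(delta_mx 0 j) (fun y => \det (P i y)) z) i j.
exact: etrans E1 (etrans E (esym E2)).
Qed.

Lemma det_system_z0 : p z0 = 0.
Proof. by case: simple_z0. Qed.

(* [G] inverts [det_system P] near [z0], so that [x] are the coordinates
   x_i = det P_i around the eigenvalue. *)
Record chart (r rho L : R) (G : 'rV[C]_d -> 'rV[C]_d) : Prop := Chart {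
  chart_r : 0 < r;
  chart_rho : 0 < rho;
  chart_dom : forall z, nrm1 (z - z0) < r ->
    [/\ U z, W z & \det (jac_det_system P z) != 0];
  chart_inj : forall z z', nrm1 (z - z0) < r -> nrm1 (z' - z0) < r ->
    p z = p z' -> z = z';
  chart_inv : forall x, nrm1 x < rho -> nrm1 (G x - z0) < r /\ p (G x) = x;
  chart_lip : forall x x', nrm1 x < rho -> nrm1 x' < rho ->
    nrm1 (G x - G x') <= L * nrm1 (x - x');
  chart_cont : forall x, nrm1 x < rho -> {for x, continuous G};
  chart_C1 : forall j, C1_on [set x | nrm1 x < rho] (fun x => G x 0 j);
  chart_det : forall x, nrm1 x < rho ->
    \det (\matrix_(j, k) 'D_(delta_mx 0 k) (fun y => G y 0 j) x : 'M[C]_d) =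
    (\det (jac_det_system P (G x)))^-1 }.

Lemma chart_exists : nbhs z0 U -> exists r rho L G, chart r rho L G.
Proof.
move=> nU.
have J0 : \det (jacobian_mx p z0) != 0.
  by rewrite jacobian_det_system; case: simple_z0.
have [r [rho [L [G [[r0 rho0 L0] [dom inj inv lip]]]]]] :=
  local_inverse_exists oW det_system_C1 Wz0 J0 nU.
have rW z : nrm1 (z - z0) < r -> W z /\ \det (jacobian_mx p z) != 0.
  by move=> /dom[].
have cont := @inverse_continuous R d p z0 rho L G L0 lip.
have C1 := @inverse_C1 R d W p z0 oW det_system_C1 r rho L G L0 rW inv lip.
have det := @inverse_det R d W p z0 oW det_system_C1 r rho L G L0 rW inv lip.
rewrite det_system_z0 in inv lip cont C1 det.
have E : [set x : 'rV[C]_d | nrm1 (x - 0) < rho] = [set x | nrm1 x < rho].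
  by apply/funext => x /=; rewrite subr0.
rewrite E in C1.
exists r, rho, L, G; apply: Chart => [||z zr||x xr|x x' xr x'r|x xr||x xr].
- exact: r0.
- exact: rho0.
- by have [Uz Wz Jz] := dom z zr; split; [exact: Uz|exact: Wz|rewrite -jacobian_det_system].
- exact: inj.
- by apply: inv; rewrite subr0.
- by apply: lip; rewrite subr0.
- by apply: cont; rewrite /= subr0.
- exact: C1.
by rewrite -jacobian_det_system; apply: det; rewrite /= subr0.
Qed.

Section Chart.
Variables (r rho L : R) (G : 'rV[C]_d -> 'rV[C]_d).
Hypothesis HG : chart r rho L G.

Local Notation B := [set x : 'rV[C]_d | nrm1 x < rho].

Lemma open_chart : open B.
Proof.
have := @open_nrm1_ball R d 0 rho.
rewrite (_ : [set y : 'rV[C]_d | nrm1 (y - 0) < rho] = B) //.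
by apply/funext => x /=; rewrite subr0.
Qed.

Lemma chart0 : B 0.
Proof. by rewrite /= nrm1_0; exact: chart_rho HG. Qed.

Lemma nbhs_chart0 : nbhs (0 : 'rV[C]_d) B.
Proof. by apply: open_nbhs_nbhs; split; [exact: open_chart|exact: chart0]. Qed.

Lemma chart_0 : G 0 = z0.
Proof.
have [Gr pG] := chart_inv HG chart0.
apply: (chart_inj HG) => //; first by rewrite subrr nrm1_0 (chart_r HG).
by rewrite pG det_system_z0.
Qed.

Lemma chart_W x : B x -> W (G x).
Proof. by move=> /(chart_inv HG)[/(chart_dom HG)[]]. Qed.

Lemma chart_U x : B x -> U (G x).
Proof. by move=> /(chart_inv HG)[/(chart_dom HG)[]]. Qed.

Lemma chart_detP x i : B x -> \det (P i (G x)) = x 0 i.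
Proof.
by move=> /(chart_inv HG)[_ pG]; rewrite -[in RHS]pG det_systemE.
Qed.

Lemma C1_chart f : C1_on W f -> C1_on B (fun x => f (G x)).
Proof.
by move=> fW; have [] := C1_on_comp open_chart (chart_C1 HG) chart_W fW.
Qed.

Lemma chart_cancel : \forall y \near z0, G (p y) = y.
Proof.
have n1 : nbhs z0 (fun y => nrm1 (y - z0) < r).
  by apply/nbhs_rVP; exists r => //; exact: chart_r HG.
have cp : {for z0, continuous p}.
  apply: continuous_rV => j; exact: C1_on_continuous (det_system_C1 j) Wz0.
have n2 : nbhs z0 (fun y => B (p y)).
  have nB : nbhs (p z0) B by rewrite det_system_z0; exact: nbhs_chart0.
  exact: cp _ nB.
apply: filterS2 n1 n2 => y y1 y2.
by have [Gr pG] := chart_inv HG y2; apply: (chart_inj HG).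
Qed.

Lemma chart_is_local_inverse : is_local_inverse p z0 G.
Proof.
have c0 : {for 0, continuous G} by apply: (chart_cont HG); exact: chart0.
have r0 : nbhs (0 : 'rV[C]_d) (fun x => p (G x) = x).
  by apply: filterS nbhs_chart0 => x Bx; have [] := chart_inv HG Bx.
by rewrite /is_local_inverse det_system_z0; split; [exact: c0|exact: chart_cancel|exact: r0].
Qed.

(** The inverse picked by [xget] is known only through [is_local_inverse]. Its continuity brings its
    values near 0 into the ball where [p] is injective, and there it has the same image under [p] as
    [G]. *)
Lemma local_inverse_chart :
  nbhs (0 : 'rV[C]_d) (fun x => local_inverse p z0 x = G x).
Proof.
have [Hc Hl Hr] : is_local_inverse p z0 (local_inverse p z0).
  by apply: (@xgetPex _ (fun=> z0) [set G | is_local_inverse p z0 G]); exists G;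
     exact: chart_is_local_inverse.
have l0 : local_inverse p z0 0 = z0.
  by rewrite -[in LHS]det_system_z0; exact: (nbhs_singleton Hl).
rewrite det_system_z0 in Hc Hr.
have n1 : nbhs (0 : 'rV[C]_d) (fun x => nrm1 (local_inverse p z0 x - z0) < r).
  have nz : nbhs (local_inverse p z0 0) (fun y => nrm1 (y - z0) < r).
    by rewrite l0; apply/nbhs_rVP; exists r => //; exact: chart_r HG.
  exact: Hc _ nz.
have n2 : nbhs (0 : 'rV[C]_d) (fun x => p (local_inverse p z0 x) = x) := Hr.
have n3 := @filterI _ _ (nbhs_filter (0 : 'rV[C]_d)) _ _ n1
  (@filterI _ _ (nbhs_filter (0 : 'rV[C]_d)) _ _ n2 nbhs_chart0).
apply: (@filterS _ _ (nbhs_filter (0 : 'rV[C]_d)) _ _ _ n3) => x [x1 [x2 Bx]].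
have [Gr pG] := chart_inv HG Bx.
apply: (chart_inj HG) => //; exact: etrans x2 (esym pG).
Qed.

Lemma dP_ddet_chart i a b :
  dP_ddet P i z0 a b = 'D_(delta_mx 0 i) (fun x => P i (G x) a b) 0.
Proof.
rewrite mxE det_system_z0; apply: near_eq_derive.
by apply: (@filterS _ _ (nbhs_filter (0 : 'rV[C]_d)) _ _ _ local_inverse_chart) => x ->.
Qed.

Lemma chart_derive_det i : 'D_(delta_mx 0 i) (fun x => \det (P i (G x))) 0 = 1.
Proof.
have <- : 'D_(delta_mx 0 i) (fun x : 'rV[C]_d => x 0 i) 0 = 1.
  by rewrite derive_coord eqxx.
apply: near_eq_derive.
apply: (@filterS _ _ (nbhs_filter (0 : 'rV[C]_d)) _ _ _ nbhs_chart0) => x Bx.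
exact: chart_detP.
Qed.

Lemma adj_derivative i : exists E : 'M[C]_(n i),
  E *m P i z0 + \adj (P i z0) *m dP_ddet P i z0 = 1%:M.
Proof.
have CP a b : C1_on B (fun x => P i (G x) a b) by exact: C1_chart (PW a b).
have CA a b : C1_on B (fun x => (\adj (P i (G x))) a b).
  exact: (@funalg_adj _ _ _ (funalg_C1_on open_chart) _ (fun x => P i (G x)) CP).
have dP a b : derivable (fun x => P i (G x) a b) 0 (delta_mx 0 i).
  by apply: diff_derivable; exact: (CP a b).1 _ chart0.
have dA a b : derivable (fun x => (\adj (P i (G x))) a b) 0 (delta_mx 0 i).
  by apply: diff_derivable; exact: (CA a b).1 _ chart0.
have := derive_adj_mulmx dP dA (chart_derive_det i) (@dP_ddet_chart i).
by rewrite chart_0.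
Qed.

End Chart.
End SimpleEigenvalue.

(** * The residue integrand on the torus *)

Lemma det_col_scale (K : comPzRingType) d (b : 'I_d -> K) (M : 'M[K]_d) :
  \det (\matrix_(j, k) (b k * M j k)) = (\prod_k b k) * \det M.
Proof.
rewrite (_ : \matrix_(j, k) (b k * M j k) = M *m diag_mx (\row_k b k)).
  rewrite det_mulmx det_diag mulrC; congr (_ * _).
  by apply: eq_bigr => k _; rewrite mxE.
by rewrite mul_mx_diag; apply/matrixP => j k; rewrite !mxE mulrC.
Qed.

Lemma prod_const_mul (K : comPzRingType) d (c : K) (x : 'I_d -> K) :
  \prod_k (c * x k) = c ^+ d * \prod_k x k.
Proof. by rewrite big_split /= prodr_const card_ord. Qed.

(** The poles [1 / x_k] of the inverse Kronecker product meet the factors [c * x_k] of the volume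
    form, where [dx_k = i x_k dt_k] on the torus; only the power of [c] survives. *)
Lemma residue_cancel (K : fieldType) d (c g D A : K) (x : 'I_d -> K) :
  (forall k, x k != 0) ->
  g * ((\prod_k (x k)^-1) * A) * ((\prod_k (c * x k)) * D) = c ^+ d * (g * (D * A)).
Proof.
move=> x0; have e : (\prod_k (x k)^-1) * (\prod_k x k) = 1.
  by rewrite -big_split big1 //= => k _; rewrite mulVf.
rewrite prod_const_mul; move: e; set a := \prod_k (x k)^-1; set b := \prod_k x k.
move=> e; rewrite -[RHS]mul1r -[X in _ = X * _]e; ring.
Qed.

Lemma residue_constant (K : fieldType) d (t i : K) : t != 0 -> i != 0 -> forall h : K,
  (1 / (i * t)) ^+ d * (t ^+ d * (i ^+ d * h)) = h.
Proof.
move=> t0 i0 h; rewrite !mulrA -!exprMn.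
have -> : 1 / (i * t) * t * i = 1 by field; rewrite t0 i0.
by rewrite expr1n mul1r.
Qed.

Section ResidueDensity.
Variables (R : realType) (d : nat) (n : 'I_d -> nat).
Local Notation C := (Cplx R).
Local Notation Re := (@complex.Re R).
Local Notation Im := (@complex.Im R).
Variables (W U : set 'rV[C]_d) (P : forall i : 'I_d, 'rV[C]_d -> 'M[C]_(n i)).
Variables (g : 'rV[C]_d -> C) (z0 : 'rV[C]_d).
Hypothesis oW : open W.
Hypothesis PW : forall i (a b : 'I_(n i)), C1_on W (fun z => P i z a b).
Hypothesis gW : C1_on W g.
Variables (r rho L : R) (G : 'rV[C]_d -> 'rV[C]_d).
Hypothesis HG : chart W U P z0 r rho L G.

Local Notation B := [set x : 'rV[C]_d | nrm1 x < rho].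
Local Notation rho1 := (rho / d.+1%:R).

Definition inverse_jacobian (x : 'rV[C]_d) : 'M[C]_d :=
  \matrix_(j, k) 'D_(delta_mx 0 k) (fun y => G y 0 j) x.

Definition residue_density a b (x : 'rV[C]_d) : C :=
  g (G x) * (\det (inverse_jacobian x) * kron (fun i => \adj (P i (G x))) a b).

Lemma rho1_gt0 : 0 < rho1.
Proof. by rewrite divr_gt0 // (chart_rho HG). Qed.

(** This explains the divisor [d.+1]: [d] coordinates and one displacement, each of modulus below
    [rho1], have total l1 norm below [rho]. *)
Lemma polydisc_line_chart x (c : C) k : polydisc rho1 x -> cmod c < rho1 ->
  B (x + c *: delta_mx 0 k).
Proof.
move=> xr cr; apply: le_lt_trans (nrm1D _ _) _; rewrite nrm1_delta.
apply: (@le_lt_trans _ _ (\sum_(j < d) rho1 + cmod c)).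
  by rewrite lerD2r; apply: ler_sum => j _; exact: ltW (xr j).
rewrite sumr_const card_ord -(mulr_natl rho1 d).
apply: (@lt_le_trans _ _ (d%:R * rho1 + rho1)); first by rewrite ltrD2l.
by rewrite -{2}[rho1]mul1r -mulrDl -[1]/(1%:R) -natrD addn1 mulrC divfK.
Qed.

Lemma polydisc_chart x : polydisc rho1 x -> B x.
Proof.
move=> xr; apply: (@le_lt_trans _ _ (\sum_(j < d) rho1)).
  by apply: ler_sum => j _; exact: ltW (xr j).
rewrite sumr_const card_ord -(mulr_natl rho1 d) mulrA ltr_pdivrMr // mulrC.
by rewrite ltr_pM2l ?(chart_rho HG) // ltr_nat.
Qed.

Lemma residue_density_limit_class a b : limit_class rho1 (residue_density a b).
Proof.
have [Cc CD CM] := @funalg_limit_class R d rho1.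
have CB f : C1_on B f -> limit_class rho1 f.
  by move=> fB; apply: C1_on_limit_class; exact: C1_on_subset polydisc_chart fB.
apply: (CM (fun x => g (G x)) (fun x => \det (inverse_jacobian x) *
    kron (fun i => \adj (P i (G x))) a b)).
  by apply: CB; exact: (C1_chart HG gW).
have H := CM (fun x => \det (inverse_jacobian x))
  (fun x => kron (fun i => \adj (P i (G x))) a b).
apply: H.
  apply: (@funalg_det _ _ _ (@funalg_limit_class R d rho1) d inverse_jacobian).
  move=> j k.
  have E : (fun x => inverse_jacobian x j k) = 'D_(delta_mx 0 k) (fun y => G y 0 j).
    by apply/funext => x; exact: mxE.
  rewrite E; apply: (@derive_limit_class R d rho1 L B).
  - exact: rho1_gt0.
  - exact: open_chart.
  - exact: chart_C1 HG j.
  - move=> x x' Bx Bx'; apply: le_trans (chart_lip HG Bx Bx').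
    apply: le_trans (cmod_le_nrm1 _ j).
    by rewrite mxE [X in _ <= cmod (_ + X)]mxE.
  by move=> x c; exact: polydisc_line_chart.
apply: (@funalg_kron _ _ _ (@funalg_limit_class R d rho1) d n n
  (fun i x => \adj (P i (G x)))) => i a' b'.
apply: (@funalg_adj _ _ _ (@funalg_limit_class R d rho1) (n i) (fun x => P i (G x))).
by move=> a'' b''; apply: CB; exact: (C1_chart HG (PW a'' b'')).
Qed.

Lemma torus_polydisc (eps : R) t : 0 <= eps < rho1 -> polydisc rho1 (torus eps t : 'rV[C]_d).
Proof.
by move=> /andP[e0 e1] j; rewrite mxE cmod_real_cis ger0_norm.
Qed.

Section Sheet.
Variable eps : R.
Hypothesis eps0 : 0 < eps.
Hypothesis eps1 : eps < rho1.

Lemma torus_chart t : B (torus eps t).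
Proof. by apply: polydisc_chart; apply: torus_polydisc; rewrite ltW. Qed.

Definition sheet (t : 'rV[R]_d) : 'rV[C]_d := G (torus eps t).

Lemma Re_coordE j : Re_coord sheet j = fun t => Re (1 * G (torus eps t) 0 j).
Proof. by apply/funext => t; rewrite mul1r. Qed.

Lemma Im_as_Re (z : C) : Im z = Re ((0 -i* 1 : C) * z).
Proof. by rewrite ReCM /= mul0r sub0r mulN1r opprK. Qed.

Lemma Im_coordE j :
  Im_coord sheet j = fun t => Re ((0 -i* 1 : C) * G (torus eps t) 0 j).
Proof. by apply/funext => t; rewrite -Im_as_Re. Qed.

Lemma sheet_C1 j : C1_on setT (Re_coord sheet j) /\ C1_on setT (Im_coord sheet j).
Proof.
rewrite Re_coordE Im_coordE; split.
  by have [] := torus_C1 1 (ltW eps0) (chart_C1 HG j) torus_chart.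
by have [] := torus_C1 (0 -i* 1 : C) (ltW eps0) (chart_C1 HG j) torus_chart.
Qed.

(** By the chain rule, column [k] of the Jacobian of the sheet is column [k] of the Jacobian of [G]
    times [dx_k/dt_k = i x_k]. *)
Lemma det_jac_param t : \det (jac_param sheet t) =
  (\prod_k ((0 +i* 1 : C) * (torus eps t) 0 k)) * \det (inverse_jacobian (torus eps t)).
Proof.
rewrite -det_col_scale; congr (\det _); apply/matrixP => j k.
have E1 : jac_param sheet t j k = 'D_(delta_mx 0 k) (Re_coord sheet j) t +i*
   'D_(delta_mx 0 k) (Im_coord sheet j) t by exact: mxE.
have E2 : (torus eps t) 0 k = ((eps%:C : C) * cis (t 0 k)) by exact: mxE.
have E3 : inverse_jacobian (torus eps t) j k =
  'D_(delta_mx 0 k) (fun y => G y 0 j) (torus eps t) by exact: mxE.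
rewrite E1 Re_coordE Im_coordE [RHS]mxE E2 E3.
have [_ ->] := torus_C1 1 (ltW eps0) (chart_C1 HG j) torus_chart.
have [_ ->] := torus_C1 (0 -i* 1 : C) (ltW eps0) (chart_C1 HG j) torus_chart.
have -> : (0 +i* 1 : C) * ((eps%:C : C) * cis (t 0 k)) =
    (eps%:C : C) * (- sin (t 0 k) +i* cos (t 0 k)).
  by apply: complex_eqP; rewrite !(ReCM, ImCM) /=; ring.
move: ('D_(delta_mx 0 k) _ _) ((eps%:C : C) * _) => D b.
by rewrite mul1r -Im_as_Re; exact: complex_eta.
Qed.

Lemma pullback_sheet a b t : pullback (fun z => omega_coef P g z a b) sheet t =
  (0 +i* 1 : C) ^+ d * residue_density a b (torus eps t).
Proof.
have tor0 k : (torus eps t) 0 k != 0 :> C.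
  by rewrite mxE -cmod_gt0 cmod_real_cis gtr0_norm.
have detE i : \det (P i (sheet t)) = (torus eps t) 0 i.
  exact: (chart_detP HG i (@torus_chart t)).
rewrite /pullback det_jac_param /residue_density -(residue_cancel _ _ _ _ tor0).
congr (_ * _).
have E : omega_coef P g (sheet t) a b = g (sheet t) * invmx (kron (fun i => P i (sheet t))) a b.
  exact: mxE.
rewrite E; congr (_ * _).
rewrite invmx_kron => [|i]; last by rewrite detE.
have E' : ((\prod_i (\det (P i (sheet t)))^-1) *: kron (fun i => \adj (P i (sheet t)))) a b =
  (\prod_i (\det (P i (sheet t)))^-1) * kron (fun i => \adj (P i (sheet t))) a b by exact: mxE.
rewrite E'; congr (_ * _).
by apply: eq_bigr => i _; rewrite detE.
Qed.

Lemma cube_integral_sheet a b :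
  cube_integral (pullback (fun z => omega_coef P g z a b) sheet) =
  ((2 * pi)%:C : C) ^+ d * ((0 +i* 1 : C) ^+ d * residue_density a b 0).
Proof.
have -> : pullback (fun z => omega_coef P g z a b) sheet =
    fun t => (0 +i* 1 : C) ^+ d * residue_density a b (torus eps t).
  by apply/funext => t; exact: pullback_sheet.
have eps01 : 0 <= eps < rho1 by rewrite ltW.
have M := limit_class_mean (residue_density_limit_class a b).
have realX (s : R) : ((s%:C : C) ^+ d) = (s ^+ d)%:C by rewrite rmorphXn.
rewrite realX; apply: complex_eqP.
  rewrite /cube_integral [LHS]/= (cube_mean _ M eps01).
  by rewrite (ReCM (_%:C)) [X in _ - X]/= mul0r subr0.
rewrite /cube_integral [LHS]/=.
(* The imaginary part is the real part after multiplication by [-i], which the scaling factor of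
   [cube_mean] absorbs. *)
have -> : (fun t => Im ((0 +i* 1 : C) ^+ d * residue_density a b (torus eps t))) =
   fun t => Re (((0 -i* 1 : C) * (0 +i* 1 : C) ^+ d) * residue_density a b (torus eps t)).
  by apply/funext => t; rewrite -mulrA -Im_as_Re.
rewrite (cube_mean _ M eps01) -mulrA -Im_as_Re.
by rewrite (ImCM (_%:C)) /= mul0r addr0.
Qed.

End Sheet.

End ResidueDensity.

(** * The residue cycle *)

Lemma mul_div_congr (K : fieldType) (a a' b c k k' : K) :
  a = a' -> b = c^-1 -> k = k' -> a * (b * k) = a' / c * k'.
Proof. by move=> -> -> ->; rewrite mulrA. Qed.

Section ResidueCycle.
Variables (R : realType) (d : nat) (n : 'I_d -> nat).
Local Notation C := (Cplx R).
Variables (W U : set 'rV[C]_d) (P : forall i : 'I_d, 'rV[C]_d -> 'M[C]_(n i)).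
Variables (g : 'rV[C]_d -> C) (z0 : 'rV[C]_d).
Hypothesis oW : open W.
Hypothesis PW : forall i (a b : 'I_(n i)), C1_on W (fun z => P i z a b).
Hypothesis gW : C1_on W g.
Variables (r rho L : R) (G : 'rV[C]_d -> 'rV[C]_d).
Hypothesis HG : chart W U P z0 r rho L G.

Local Notation p := (det_system P).
Local Notation B := [set x : 'rV[C]_d | nrm1 x < rho].
Local Notation rho1 := (rho / d.+1%:R).

Lemma eigenvalueP z : p z = 0 -> is_eigenvalue P z.
Proof.
move=> pz i; rewrite unitmxE unitfE negbK -det_systemE pz.
by apply/eqP; exact: mxE.
Qed.

Lemma closure_bounded (V : set 'rV[C]_d) : bounded_set V ->
  exists M : R, forall z, closure V z -> forall j, cmod (z 0 j) <= M.
Proof.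
move=> [M [Mreal bM]].
(* Any scalar above [M] bounds the set; [M + 1] is one, and being a real element of [C] it is
   determined by its real part. *)
pose N := complex.Re (M + 1).
have NE : M + 1 = (N%:C : C).
  by rewrite /N RRe_real // realD // real1.
have VN z : V z -> forall j, cmod (z 0 j) <= N.
  move=> Vz j; rewrite -lerC -normcE -NE.
  apply: le_trans (ler_coord_mx_norm z j) _.
  by apply: (bM (M + 1)) => //; rewrite ltrDl.
exists N => z Vz j; rewrite leNgt; apply/negP => zN.
have nz : nbhs z (fun y : 'rV[C]_d => N < cmod (y 0 j)).
  have e0 : 0 < cmod (z 0 j) - N by rewrite subr_gt0.
  have /(@cvgrPdist_lt R R^o _ (nbhs z) _) /(_ _ e0) := @cmod_coord_continuous R d j z.
  apply: filterS => y; rewrite ltr_norml => /andP[_ h].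
  by move: h; rewrite ltrBlDr addrC -ltrBlDr opprB addrC subrK.
have [y [Vy /= hy]] := Vz _ nz.
by move: (VN y Vy j); rewrite leNgt hy.
Qed.

(** Injectivity of [p] is known only in the ball around [z0]. Off that ball [p] has no zero on the
    compact set [K], so its l1 norm has a positive minimum there, whereas on Gamma this norm is
    [d * eps]. *)
Lemma Gamma_localized : bounded_set U -> closure U `<=` W ->
  (forall z, closure U z -> is_eigenvalue P z -> z = z0) ->
  exists2 m : R, 0 < m & forall eps : R, eps < m ->
    forall z, Gamma P U eps z -> nrm1 (z - z0) < r.
Proof.
move=> bU UW only.
pose K := closure U `&` [set z | r <= nrm1 (z - z0)].
have cK : closed K.
  apply: closedI; first exact: closed_closure.
  rewrite (_ : [set z | r <= nrm1 (z - z0)] = ~` [set z | nrm1 (z - z0) < r]).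
    by apply: open_closedC; exact: open_nrm1_ball.
  by apply/seteqP; split=> z /=; rewrite leNgt => /negP.
have [M MP] := closure_bounded bU.
have compK : compact K.
  by apply: (@closed_bounded_compact R d K M cK) => z [/MP].
have GK (eps : R) z : Gamma P U eps z -> ~ nrm1 (z - z0) < r -> K z.
  move=> [Uz _] zr; split; first exact: subset_closure.
  by rewrite /= leNgt; exact/negP.
have nG (eps : R) z : Gamma P U eps z -> nrm1 (p z) = d%:R * eps.
  move=> [_ H]; rewrite /nrm1 -[X in X%:R]card_ord mulr_natl -sumr_const.
  apply: eq_bigr => j _; rewrite det_systemE.
  by have := H j; rewrite normcE => /(@complexI R).
(* If [K] is empty, Gamma cannot leave the ball and any threshold will do. *)
have [[k Kk]|K0] := pselect (exists z, K z); last first.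
  exists 1 => // eps _ z Gz; apply: contrapT => zr.
  by apply: K0; exists z; exact: GK Gz zr.
have [c cK' cmin] : exists2 c, c \in K & forall t, t \in K -> nrm1 (p c) <= nrm1 (p t).
  apply: (@compact_EVT_min _ R (fun z => nrm1 (p z)) K) => //; first by exists k.
  apply: continuous_in_subspaceT => z; rewrite inE => -[Uz _].
  have cp : {for z, continuous p}.
    by apply: continuous_rV => j; exact: C1_on_continuous (det_system_C1 oW PW j) (UW _ Uz).
  exact: (@continuous_comp _ _ _ _ _ z cp (@nrm1_continuous R d _)).
have {cK'} [Uc cr] : K c by move: cK'; rewrite inE.
have pc : 0 < nrm1 (p c).
  rewrite lt_def nrm1_ge0 andbT; apply/eqP => /nrm1_eq0 pc0.
  have cz := only c Uc (eigenvalueP pc0).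
  by move: cr; rewrite /= cz subrr nrm1_0 leNgt (chart_r HG).
exists (nrm1 (p c) / d.+1%:R); first by rewrite divr_gt0.
move=> eps epsm z Gz; apply: contrapT => zr.
have := cmin z; rewrite inE => /(_ (GK _ _ Gz zr)); rewrite (nG _ _ Gz).
apply/negP; rewrite -ltNge.
have [e0|e0] := lerP eps 0.
  by apply: le_lt_trans pc; rewrite mulr_ge0_le0.
apply: (@le_lt_trans _ _ (d.+1%:R * eps)); first by rewrite ler_pM2r // ler_nat.
by rewrite mulrC -ltr_pdivlMr.
Qed.

Section Epsilon.
Variable eps : R.
Hypothesis eps0 : 0 < eps.
Hypothesis eps1 : eps < rho1.
Hypothesis Gamma_r : forall z, Gamma P U eps z -> nrm1 (z - z0) < r.

Let sh := sheet G eps.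

Lemma det_sheet t i : \det (P i (sh t)) = (eps%:C : C) * cis (t 0 i).
Proof.
have h := chart_detP HG i (torus_chart HG eps0 eps1 t).
by apply: etrans h _; exact: mxE.
Qed.

Lemma sheet_Gamma t : Gamma P U eps (sh t).
Proof.
split; first exact: (chart_U HG (torus_chart HG eps0 eps1 t)).
by move=> i; rewrite det_sheet normcE cmod_real_cis gtr0_norm.
Qed.

Lemma chart_torusK z (t : 'rV[R]_d) : Gamma P U eps z ->
  (forall i, \det (P i z) = (eps%:C : C) * cis (t 0 i)) -> sh t = z.
Proof.
move=> Gz dz; have [Gr pG] := chart_inv HG (torus_chart HG eps0 eps1 t).
apply: (chart_inj HG) => //; first exact: Gamma_r.
apply: etrans pG _; apply/rowP => i; rewrite det_systemE dz; exact: mxE.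
Qed.

Lemma Gamma_sheet z : Gamma P U eps z ->
  exists t : 'rV[R]_d, (forall i, 0 <= t 0 i < 2 * pi) /\ sh t = z.
Proof.
move=> Gz.
have epsC : (eps%:C : C) != 0 by rewrite -cmod_gt0 cmodC gtr0_norm.
have arg i : exists t : R, 0 <= t < 2 * pi /\ (eps%:C : C) * cis t = \det (P i z).
  have [t t2 ct] : exists2 t : R, 0 <= t < 2 * pi & cis t = (eps%:C : C)^-1 * \det (P i z).
    apply: cis_surj; rewrite cmodM cmodV cmodC gtr0_norm //.
    have -> : cmod (\det (P i z)) = eps.
      by have [_ /(_ i)] := Gz; rewrite normcE => /(@complexI R).
    by rewrite mulVf // gt_eqF.
  by exists t; split; rewrite // ct mulVKf.
have [f fP] := choice arg.
exists (\row_i f i); split=> [i|]; first by rewrite mxE; exact: (fP i).1.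
apply: chart_torusK => // i; rewrite -(fP i).2; congr (_ * cis _).
by rewrite mxE.
Qed.

Lemma sheet_inj (t t' : 'rV[R]_d) : (forall i, 0 <= t 0 i < 2 * pi) ->
  (forall i, 0 <= t' 0 i < 2 * pi) -> sh t = sh t' -> t = t'.
Proof.
move=> ht ht' E.
have epsC : (eps%:C : C) != 0 by rewrite -cmod_gt0 cmodC gtr0_norm.
apply/rowP => i; apply: (@cis_inj R) => //.
by apply: (mulfI epsC); rewrite -!det_sheet E.
Qed.

Lemma sheet_parametrization : arg_parametrization P U eps (fun _ : 'I_1 => sh).
Proof.
split=> [c j|c t|z Gz].
- exact: (sheet_C1 HG eps0 eps1 j).
- split; first exact: sheet_Gamma.
  by move=> i; exact: det_sheet.
have [t [t2 tz]] := Gamma_sheet Gz.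
exists (ord0, t); split=> [//|[c t'] [/= t'2 t'z]].
by rewrite (ord1 c); congr (_, _); apply: sheet_inj => //; rewrite tz t'z.
Qed.

(** The closed cube has the same image under the sheet as the half-open one, and it is compact. *)
Lemma compact_Gamma : compact (Gamma P U eps).
Proof.
have -> : Gamma P U eps = sh @` [set t : 'rV[R]_d | forall i, `[0, 2 * pi]%classic (t ord0 i)].
  apply/seteqP; split=> [z /Gamma_sheet[t [t2 tz]]|_ [t _ <-]]; last exact: sheet_Gamma.
  exists t => // i; have /andP[a b] := t2 i.
  by rewrite /= in_itv /= a ltW.
apply: continuous_compact.
  apply: continuous_subspaceT => t.
  have ct : {for t, continuous (fun t : 'rV[R]_d => torus eps t)}.
    by apply: continuous_rV => j; exact: torus_coord_continuous.
  exact: (@continuous_comp _ _ _ _ _ t ct (chart_cont HG (torus_chart HG eps0 eps1 t))).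
exact: (@rV_compact R d (fun=> `[0, 2 * pi]%classic)
  (fun=> @segment_compact R 0 (2 * pi))).
Qed.

(** Injectivity of [p] on Gamma forces every sheet to equal [sh]. The covering condition at the
    single point [sh 0] then yields one index and excludes a second, so the sum has exactly one
    term. *)
Lemma parametrization_unique m (gam : 'I_m -> 'rV[R]_d -> 'rV[C]_d) (F : 'rV[C]_d -> C) :
  arg_parametrization P U eps gam ->
  \sum_(c < m) cube_integral (pullback F (gam c)) = cube_integral (pullback F sh).
Proof.
move=> [_ Hg Huniq].
have gamE c : gam c = sh.
  by apply/funext => t; have [Gt dt] := Hg c t; apply/esym/chart_torusK.
have pi2 : 0 < 2 * pi :> R by rewrite mulr_gt0 // pi_gt0.
have [[c t] [[_ E] U1]] := Huniq _ (sheet_Gamma 0).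
have all_c c' : c' = c.
  have h : (forall i, 0 <= ((c', 0 : 'rV[R]_d).2) 0 i < 2 * pi) /\
      gam (c', 0 : 'rV[R]_d).1 (c', 0 : 'rV[R]_d).2 = sh 0.
    by split=> [i|]; [rewrite /= mxE lexx pi2|rewrite /= gamE].
  by have [] := U1 _ h.
rewrite (bigD1 c) //= big1 ?addr0 ?gamE // => c' /eqP; case; exact: all_c.
Qed.

Lemma Gamma_integral_sheet F : Gamma_integral P U eps F = cube_integral (pullback F sh).
Proof.
apply: xget_unique.
  exists 1%N, (fun _ : 'I_1 => sh); split; first exact: sheet_parametrization.
  by rewrite big_ord1.
by move=> I [m [gam [Hg ->]]]; exact: parametrization_unique.
Qed.

Lemma matrix_residue_density :
  matrix_residue P U eps g = \matrix_(a, b) residue_density P g G a b 0.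
Proof.
have i0 : (0 +i* 1 : C) != 0.
  by apply/eqP => /(congr1 (@complex.Im R)) /= /eqP; rewrite oner_eq0.
have pi0 : ((2 * pi)%:C : C) != 0.
  by rewrite -cmod_gt0 cmodC normr_gt0 mulf_neq0 // gt_eqF // pi_gt0.
have E : (0 +i* (2 * pi) : C) = (0 +i* 1 : C) * ((2 * pi)%:C : C).
  by apply: complex_eqP; rewrite ?(ReCM, ImCM) /=; ring.
apply/matrixP => a b; rewrite /matrix_residue E.
have E1 (c : C) (f : 'I_(kron_dim n) -> 'I_(kron_dim n) -> C) :
  (c *: \matrix_(a, b) f a b) a b = c * f a b by rewrite mxE mxE.
rewrite E1 Gamma_integral_sheet.
rewrite (cube_integral_sheet PW gW HG eps0 eps1).
rewrite (residue_constant d pi0 i0).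
by apply: esym; exact: mxE.
Qed.

End Epsilon.

Lemma residue_density_eigenvectors (v w : forall i : 'I_d, 'cV[C]_(n i)) :
  W z0 -> is_simple_eigenvalue P z0 ->
  (forall i, w i != 0) ->
  (forall i, P i z0 *m v i = 0) ->
  (forall i, (w i)^t* *m P i z0 = 0) ->
  (forall i, (w i)^t* *m dP_ddet P i z0 *m v i = 1%:M) ->
  \matrix_(a, b) residue_density P g G a b 0 =
  (g z0 / \det (jac_det_system P z0)) *: (kron v *m (kron w)^t*).
Proof.
move=> Wz0 simp w0 Pv wP wDv.
have adjE : (fun i => \adj (P i z0)) = (fun i => v i *m (w i)^t*).
  apply/functional_extensionality_dep => i.
  have [E EP] := adj_derivative oW PW Wz0 simp HG i.
  apply: (adj_eigenvectors _ (Pv i) (wP i) (wDv i) EP).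
  by rewrite map_mx_eq0 trmx_eq0.
rewrite kron_conjT kron_mul -adjE; apply/matrixP => a b.
have E1 : (\matrix_(a, b) residue_density P g G a b 0) a b = residue_density P g G a b 0.
  exact: mxE.
have E2 (c : C) (M : 'M[C]_(kron_dim n)) : (c *: M) a b = c * M a b by rewrite mxE.
have E3 : \det (inverse_jacobian G 0) = (\det (jac_det_system P z0))^-1.
  have h := chart_det HG (chart0 HG).
  by rewrite (chart_0 simp HG) in h; exact: h.
apply: etrans E1 (etrans _ (esym (E2 _ _))).
have G0 := chart_0 simp HG.
exact: (mul_div_congr (congr1 g G0) E3
  (congr1 (fun z => kron (fun i => \adj (P i z)) a b) G0)).
Qed.

End ResidueCycle.

Local Close Scope complex_scope.

Theorem theorem3p1 (R : realType) (d : nat) (n : 'I_d -> nat)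
    (W U : set 'rV[Cplx R]_d)
    (P : forall i : 'I_d, 'rV[Cplx R]_d -> 'M[Cplx R]_(n i))
    (g : 'rV[Cplx R]_d -> Cplx R)
    (zstar : 'rV[Cplx R]_d)
    (v w : forall i : 'I_d, 'cV[Cplx R]_(n i))
    (openW : open W)
    (openU : open U)
    (boundedU : bounded_set U)
    (closureUW : closure U `<=` W)
    (zstarU : U zstar)
    (holoP : forall (i : 'I_d) (a b : 'I_(n i)),
       holomorphic_on W (fun z => P i z a b))
    (holog : holomorphic_on W g)
    (simple_zstar : is_simple_eigenvalue P zstar)
    (only_zstar : forall z, closure U z -> is_eigenvalue P z -> z = zstar)
    (v_neq0 : forall i, v i != 0)
    (w_neq0 : forall i, w i != 0)
    (right_eigen : forall i, P i zstar *m v i = 0)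
    (left_eigen : forall i, (w i)^t* *m P i zstar = 0)
    (scaled : forall i, (w i)^t* *m dP_ddet P i zstar *m v i = 1%:M) :
  exists eps0 : R, 0 < eps0 /\
    forall eps : R, 0 < eps -> eps < eps0 ->
      Gamma_cycle P U eps /\
      matrix_residue P U eps g =
        (g zstar / \det (jac_det_system P zstar)) *: (kron v *m (kron w)^t*).
Proof.
have Wz : W zstar by apply: closureUW; exact: subset_closure.
have nU : nbhs zstar U by exact: open_nbhs_nbhs.
have [r [rho [L [G HG]]]] := chart_exists openW holoP Wz simple_zstar nU.
have [m m0 mP] := Gamma_localized openW holoP HG boundedU closureUW only_zstar.
(* The bound [m] keeps Gamma in the ball where the chart is injective; the other bound keeps the
   torus in the domain of [G]. *)
exists (Num.min m (rho / d.+1%:R)); split.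
  by rewrite lt_min m0 (rho1_gt0 HG).
move=> eps e0; rewrite lt_min => /andP[em erho].
have Gr := mP eps em.
split.
  split; first exact: (compact_Gamma HG e0 erho Gr).
  exists 1%N, (fun _ : 'I_1 => sheet G eps).
  exact: (sheet_parametrization HG e0 erho Gr).
rewrite (matrix_residue_density holoP holog HG e0 erho Gr).
exact: (residue_density_eigenvectors g openW holoP HG Wz simple_zstar w_neq0
  right_eigen left_eigen scaled).
Qed.
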